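(* Let $d\ge 2$, let $B_d\subset\mathbb{R}^d$ be the unit ball and let $Q_d=[0,1]^d$ be the unit cube. Then the following hold. (i) For $\Omega=B_d$ and for $\Omega=Q_d$: the set of $(d+1)$-tuples $(a^1,a^2,\dots,a^{d+1})\in(\mathbb{R}^d)^{d+1}$ such that $\mathcal{E}(A)$, with $A=\{a^1,a^2,\dots,a^{d+1}\}$, is not a complete exponential system in $L^2(\Omega)$ has $d(d+1)$-dimensional Lebesgue measure $0$. (ii) If $A\subset\mathbb{R}^d$ and $\#A\le d$, then $\mathcal{E}(A)$ is not a complete exponential system in $L^2(Q_d)$. (iii) The set of $d$-tuples $(a^1,\dots,a^d)\in(\mathbb{R}^d)^d$ such that $\mathcal{E}(A)$, with $A=\{a^1,\dots,a^d\}$, is a complete exponential system in $L^2(B_d)$ has $d^2$-dimensional Lebesgue measure $0$. (iv) For $\Omega=B_d$ and for $\Omega=Q_d$: for every integer $N\ge d+1$ there exist $N$ distinct points $a^1,\dots,a^N\in\mathbb{R}^d$ such that $\mathcal{E}(A)$, with $A=\{a^1,\dots,a^N\}$, is not a complete exponential system in $L^2(\Omega)$. (v) If $d=2$ and $A=\{a^1,a^2\}\subset\mathbb{R}^2$ with $a^1\neq a^2$, then $\mathcal{E}(A)$ is exponentially incomplete in $L^2(B_2)$. (vi) If $d\ge 3$, then the set of $d$-tuples $(a^1,\dots,a^d)\in(\mathbb{R}^d)^d$ such that $\mathcal{E}(A)$, with $A=\{a^1,\dots,a^d\}$, is a complete exponential system in $L^2(B_d)$ is not empty. In other words, there exists $A=\{a^1,\dots,a^d\}$,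 $a^j\in\mathbb{R}^d$, such that $\mathcal{E}(A)$ is a complete exponential system in $L^2(B_d)$.
   Context: $B_d=\{x\in\mathbb{R}^d:|x|\le 1\}$ is the Euclidean unit ball centered at the origin. For a countable set $A\subset\mathbb{R}^d$, write $\mathcal{E}(A)=\{e^{2\pi i x\cdot a}:a\in A\}$ (functions of $x$). Let $\Omega\subset\mathbb{R}^d$ be a bounded domain of positive Lebesgue measure. The system $\mathcal{E}(A)$ is called a complete exponential system in $L^2(\Omega)$ if for every $\xi\in\mathbb{R}^d$ there exists $a\in A$ such that $$\int_\Omega e^{2\pi i x\cdot(a-\xi)}\,dx\neq 0.$$ Otherwise, $\mathcal{E}(A)$ is called exponentially incomplete (not a complete exponential system) in $L^2(\Omega)$. Here $\#A$ denotes the cardinality of $A$. *)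

(* Defs.v *)
From HB Require Import structures.
From mathcomp Require Import all_boot all_order all_algebra.
From mathcomp Require Import complex.
From mathcomp Require Import all_classical all_reals all_analysis.

Set Implicit Arguments.
Unset Strict Implicit.
Unset Printing Implicit Defensive.

Import Order.TTheory GRing.Theory Num.Theory.
Import numFieldNormedType.Exports.

Local Open Scope classical_set_scope.
Local Open Scope ring_scope.

Section tuple_cons.
Context {d : measure_display} {T : measurableType d} {n : nat}.

Definition tuple_cons (xt : T * n.-tuple T) : n.+1.-tuple T :=
  [tuple of xt.1 :: xt.2].

Definition tuple_uncons (t : n.+1.-tuple T) : T * n.-tuple T :=
  (thead t, [tuple of behead t]).

Lemma tuple_consK : cancel tuple_cons tuple_uncons.
Proof. by case=> x t; congr pair; apply/val_inj. Qed.

Lemma tuple_unconsK : cancel tuple_uncons tuple_cons.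
Proof. by move=> t; rewrite [RHS]tuple_eta. Qed.

Lemma measurable_tuple_cons : measurable_fun [set: T * n.-tuple T] tuple_cons.
Proof. exact: measurable_cons. Qed.

Lemma measurable_tuple_uncons : measurable_fun [set: n.+1.-tuple T] tuple_uncons.
Proof.
by apply/measurable_fun_pairP; split; [exact: measurable_tnth|exact: measurable_behead].
Qed.

End tuple_cons.

Section tuple_measure_step.
Context {d : measure_display} {T : measurableType d} {R : realType} {n : nat}.
Variables (mu : {sigma_finite_measure set T -> \bar R}).
Variable nu : {sigma_finite_measure set (n.-tuple T) -> \bar R}.

Definition tuple_measure_step : set (n.+1.-tuple T) -> \bar R :=
  pushforward (mu \x nu)%E tuple_cons.

Let step0 : tuple_measure_step set0 = 0%E.
Proof. by have mc := @measurable_tuple_cons d T n; exact: measure0. Qed.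

Let step_ge0 A : (0 <= tuple_measure_step A)%E.
Proof. by have mc := @measurable_tuple_cons d T n; exact: measure_ge0. Qed.

Let step_sigma_additive : semi_sigma_additive tuple_measure_step.
Proof.
by have mc := @measurable_tuple_cons d T n; exact: measure_semi_sigma_additive.
Qed.

HB.instance Definition _ := isMeasure.Build _ _ _ tuple_measure_step
  step0 step_ge0 step_sigma_additive.

Let step_sigma_finite : sigma_finite setT tuple_measure_step.
Proof.
have /sigma_finiteP[F [TF ndF Foo]] := sigma_finiteT mu.
have /sigma_finiteP[G [TG ndG Goo]] := sigma_finiteT nu.
exists (fun k => tuple_uncons @^-1` (F k `*` G k)).
  rewrite -preimage_bigcup (_ : \bigcup_k _ = setT) ?preimage_setT//.
  rewrite -subTset => -[x y] _.
  have [[i _ Fix] [j _ Gjy]] : (\bigcup_k F k) x /\ (\bigcup_k G k) y.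
    by rewrite -TF -TG.
  exists (maxn i j) => //; split.
  - by move: x Fix; exact/subsetPset/ndF/leq_maxl.
  - by move: y Gjy; exact/subsetPset/ndG/leq_maxr.
move=> k; have [mF Fkoo] := Foo k; have [mG Gkoo] := Goo k; split.
  by rewrite -[X in measurable X]setTI; apply: measurable_tuple_uncons => //;
    exact: measurableX.
rewrite /tuple_measure_step /pushforward (_ : _ @^-1` _ = F k `*` G k).
  by rewrite product_measure1E// lte_mul_pinfty// ge0_fin_numE.
rewrite -comp_preimage (_ : _ \o _ = id) ?preimage_id//.
by apply/funext => x; exact: tuple_consK.
Qed.

HB.instance Definition _ := Measure_isSigmaFinite.Build _ _ _
  tuple_measure_step step_sigma_finite.

End tuple_measure_step.

(* The n-fold product measure mu \x ... \x mu, on the product sigma-algebra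
   that n.-tuple T carries; for n = 0 it is the unit mass on the empty tuple. *)
Fixpoint tuple_measure (d : measure_display) (T : measurableType d)
    (R : realType) (mu : {sigma_finite_measure set T -> \bar R}) (n : nat) :
    {sigma_finite_measure set (n.-tuple T) -> \bar R} :=
  if n is n'.+1 return {sigma_finite_measure set (n.-tuple T) -> \bar R}
  then tuple_measure_step mu (tuple_measure mu n')
  else \d_([tuple] : 0.-tuple T).

(* A point of R^d is a d-tuple rather than a row vector, because tuples are what
   the library equips with the product (here Borel) sigma-algebra;
   measurableTypeR R is R with its Borel sigma-algebra, on which
   lebesgue_measure is defined. *)
Notation Rn R d := (d.-tuple (measurableTypeR R)).

Section euclidean_space.
Context {R : realType} {d : nat}.
Implicit Types (x y : Rn R d) (Om A : set (Rn R d)).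

Definition lebesgue_Rn : {sigma_finite_measure set (Rn R d) -> \bar R} :=
  tuple_measure (@lebesgue_measure R) d.

(* Identifying (R^d)^m with R^(d * m), the m-fold product of the d-dimensional
   Lebesgue measure is the (d * m)-dimensional one. A null set is a set that is
   negligible for it, i.e. included in a Borel set of measure 0. *)
Definition null_tuples (m : nat) (S : set (m.-tuple (Rn R d))) : Prop :=
  (tuple_measure lebesgue_Rn m).-negligible S.

Definition Rn_sub x y : Rn R d := [tuple (tnth x j : R) - tnth y j | j < d].

Definition dotp x y : R := \sum_(j < d) (tnth x j : R) * tnth y j.

Definition enorm x : R := Num.sqrt (dotp x x).

Definition unit_ball : set (Rn R d) := [set x | enorm x <= 1].

Definition unit_cube : set (Rn R d) :=
  [set x | forall j, 0 <= (tnth x j : R) <= 1].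

(* e^(i t) *)
Definition expi (t : R) : R[i] := (cos t +i* sin t)%C.

(* Complex-valued Lebesgue integral over Om, by real and imaginary parts *)
Definition Cintegral Om (f : Rn R d -> R[i]) : R[i] :=
  ((\int[lebesgue_Rn]_(x in Om) complex.Re (f x))
     +i* (\int[lebesgue_Rn]_(x in Om) complex.Im (f x)))%C.

(* E(A) is a complete exponential system in L^2(Om). *)
Definition complete_exp_system Om A : Prop :=
  forall xi : Rn R d, exists2 a, A a &
    Cintegral Om (fun x => expi (2 * pi * dotp x (Rn_sub a xi))) != 0.

(* The set {a^1, ..., a^m} of entries of an m-tuple of points *)
Definition points (m : nat) (a : m.-tuple (Rn R d)) : set (Rn R d) :=
  range (tnth a).

End euclidean_space.

Arguments unit_ball : clear implicits.
Arguments unit_cube : clear implicits.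

(* Main.v *)
Require Import Defs.
From HB Require Import structures.
From mathcomp Require Import all_boot all_order all_algebra.
From mathcomp Require Import complex.
From mathcomp Require Import all_classical all_reals all_analysis.
From mathcomp Require Import measurable_realfun lebesgue_integral_under.
From mathcomp Require Import ring lra.
From mathcomp Require finmap.

(** Write F for the transform of the domain, F(eta) = the integral over Om of
    exp(2 i pi x.eta). Then E(A) is incomplete exactly when some translate
    A - xi lies entirely in the zero set of F, so everything reduces to a
    description of that zero set, followed by geometry.

    For the cube, F is a product of one-dimensional integrals, hence F(eta) = 0
    iff some coordinate of eta is a nonzero integer (cube_zero). With d points,
    xi can be moved, coordinate by coordinate, to distance 1 from a different
    point (cube_few_incomplete). With d + 1 points, the pigeonhole principle
    forces two of them to have an integer difference in some coordinate, which
    confines the tuple to countably many hyperplanes (cube_incomplete_null).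

    For the ball, F is radial. Rotations are products of shears, shears preserve
    Lebesgue measure by Fubini, so eta may be rotated onto the first axis
    (same_profile_axis); slicing the ball then gives F(eta) = c g(2 pi |eta|)
    with g(k) the cosine transform of (1 - t^2)^((d-1)/2) on [-1,1]
    (ball_fourier). Up to a power of k, g is a Bessel function, but all that is
    used is the equation k (g + g'') = -(d+1) g'. An energy estimate shows that
    its positive zeros are simple, hence countably many; a Sturm comparison with
    a sine wave shows that they are unbounded. So there is a countable unbounded
    set Z of radii such that F(eta) = 0 iff |eta| is in Z (ball_zeros), and E(A)
    is incomplete iff some xi is at a distance in Z from every point of A.

    - If the points of A are equidistant from all points of some line, then xi
      can be pushed along the line until the common distance is in Z
      (equidistant_incomplete). This is the case for two distinct points of the
      plane, and for d points whose edge vectors have an invertible minor: the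
      exceptional d-tuples are zeros of a nonzero polynomial.
    - If d + 1 points are at prescribed distances from a common point, Cramer's
      rule eliminates that point and leaves a nonzero polynomial relation between
      their coordinates (cosphere_poly); there are countably many choices of
      the distances in Z.
    - For the three collinear points -t e, 0, t e, distances r, s, u from a common
      point satisfy r^2 + u^2 = 2 s^2 + 2 t^2, which excludes all but countably
      many t (ball_complete_exists).

    Nonzero polynomial functions have null zero sets by Fubini and induction on
    the number of variables (null_zero_polyfun). *)

Set Implicit Arguments.
Unset Strict Implicit.
Unset Printing Implicit Defensive.

Import Order.TTheory GRing.Theory Num.Theory.
Import numFieldNormedType.Exports.

Local Open Scope classical_set_scope.
Local Open Scope ring_scope.

(** * Null zero sets of polynomial functions *)
Section tuple_upd.
Context {T : Type} {n : nat}.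

Definition tupd (x : n.-tuple T) (i : 'I_n) (t : T) : n.-tuple T :=
  [tuple if j == i then t else tnth x j | j < n].

Lemma tnth_tupd x i t j : tnth (tupd x i t) j = if j == i then t else tnth x j.
Proof. by rewrite tnth_mktuple. Qed.

Lemma tupd_id x i : tupd x i (tnth x i) = x.
Proof. by apply: eq_from_tnth => j; rewrite tnth_tupd; case: eqP => [->|]. Qed.

End tuple_upd.

Section tuple_fubini.
Context {dT : measure_display} {T : measurableType dT} {R : realType}.
Variable mu : {sigma_finite_measure set T -> \bar R}.

Lemma tuple_measure0E (A : set (0.-tuple T)) :
  tuple_measure mu 0 A = \d_([tuple] : 0.-tuple T) A.
Proof. by []. Qed.

Lemma tuple_measureSE n (A : set (n.+1.-tuple T)) :
  tuple_measure mu n.+1 A =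
  (\int[mu]_x tuple_measure mu n [set t : n.-tuple T | A (tuple_cons (x, t))])%E.
Proof.
rewrite /= /tuple_measure_step /pushforward /= /product_measure1.
apply: eq_integral => x _ /=; congr (_ _).
by apply/seteqP; split => y; rewrite /xsection /= /tuple_cons/= inE.
Qed.

Lemma measurable_consr n (x : T) :
  measurable_fun [set: n.-tuple T] (fun t : n.-tuple T => (tuple_cons (x, t))).
Proof.
have := @measurable_tuple_cons dT T n => mc.
have -> : (fun t : n.-tuple T => (tuple_cons (x, t))) = tuple_cons \o pair x by [].
by apply: measurableT_comp => //; exact: measurable_pair1.
Qed.

Lemma measurable_tuple_section n (A : set (n.+1.-tuple T)) x :
  measurable A -> measurable [set t : n.-tuple T | A (tuple_cons (x, t))].
Proof.
by move=> mA; rewrite -[X in measurable X]setTI; exact: measurable_consr.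
Qed.

Lemma measurable_fun_tuple_section n (A : set (n.+1.-tuple T)) : measurable A ->
  measurable_fun setT
    (fun x => tuple_measure mu n [set t : n.-tuple T | A (tuple_cons (x, t))]).
Proof.
move=> mA.
have mB : measurable (tuple_cons @^-1` A : set (T * n.-tuple T)).
  by rewrite -[X in measurable X]setTI; exact: measurable_tuple_cons.
have := measurable_fun_xsection (tuple_measure mu n) mB.
apply: eq_measurable_fun => x _ /=; congr (_ _).
by apply/seteqP; split => y; rewrite /xsection /= /tuple_cons/= inE.
Qed.

End tuple_fubini.

Section null_zero_sets.
Context {R : realType}.

(** The dichotomy satisfied by polynomial functions. Being stated for the measure
    and the function alone, it can be carried from R to R^d to (R^d)^m. *)
Definition thin {T : Type} (mu : set T -> \bar R)
    (f : T -> R) :=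
  (forall x, f x = 0) \/ mu [set x | f x = 0] = 0%E.

Lemma measurable_zeros {dT} {T : measurableType dT} (f : T -> R) :
  measurable_fun setT f -> measurable [set x | f x = 0].
Proof.
move=> mf; rewrite (_ : [set _ | _] = setT `&` f @^-1` [set 0]); first exact: mf.
by rewrite setTI.
Qed.

(** If f does not vanish at p, then for almost every first coordinate t it does not
    vanish at the point obtained from p by putting t first, because f is thin along
    that line. For such t, induction applies to f with first coordinate t, and Fubini
    concludes. Only the restrictions of f to lines parallel to the axes enter, so the
    lemma serves both for coordinates in R and for entries in R^d. *)
Lemma thin_tuple {dT} {T : measurableType dT}
    (mu : {sigma_finite_measure set T -> \bar R}) (C : set (T -> R))
    (mC : forall f, C f -> measurable_fun setT f)
    (hC : forall f, C f -> thin mu f)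
    n (f : n.-tuple T -> R) :
  measurable_fun setT f -> (forall x i, C (fun t => f (tupd x i t))) ->
  thin (tuple_measure mu n) f.
Proof.
elim: n f => [|n IH] f mf Cf.
  have [f0|f0] := eqVneq (f [tuple]) 0; first by left=> x; rewrite (tuple0 x).
  right; rewrite tuple_measure0E diracE memNset//=; exact/eqP.
have [f0|] := pselect (forall x, f x = 0); [by left|right].
have [p /eqP fp] : exists p, f p <> 0 by apply/existsNP.
have mA := measurable_zeros mf.
rewrite tuple_measureSE.
have thinx x : thin (tuple_measure mu n) (fun t : n.-tuple T => f (tuple_cons (x, t))).
  apply: IH; first by apply: measurableT_comp => //; exact: measurable_consr.
  move=> y i; rewrite (_ : (fun _ => _) =
     fun t => f (tupd (tuple_cons (x, y)) (lift ord0 i) t)); first exact: Cf.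
  apply/funext => t; congr f; apply: eq_from_tnth => j; rewrite tnth_tupd.
  case: (unliftP ord0 j) => [k ->|->]; last by rewrite /= !tnth0.
  by rewrite !tnthS tnth_tupd (inj_eq lift_inj).
pose g t := f (tupd p ord0 t).
have Cg : C g by exact: Cf.
have gnull : mu [set t | g t = 0] = 0%E.
  case: (hC _ Cg) => // g0; move: fp; rewrite -(tupd_id p ord0).
  by have := g0 (tnth p ord0); rewrite /g => ->; rewrite eqxx.
have mg := measurable_zeros (mC _ Cg).
rewrite -(integral0 mu setT).
apply: ge0_ae_eq_integral => //; first exact: measurable_fun_tuple_section.
exists [set t | g t = 0]; split => // x /=; apply: contra_notP => gx _.
have [f0|//] := thinx x; exfalso; apply: gx.
rewrite /g -[RHS](f0 [tuple of behead p]); congr f.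
apply: eq_from_tnth => j; rewrite tnth_tupd.
case: (unliftP ord0 j) => [k ->|->]; last by rewrite /= tnth0.
by rewrite tnthS [X in tnth X (lift _ _)](tuple_eta p) tnthS /=; congr tnth; apply/val_inj.
Qed.

(** Polynomial functions as an inductive class rather than as values of formal
    polynomials: measurability and stability under restriction to a coordinate line
    are then proved by induction, and determinants are directly in the class. *)
Inductive polyfun {T I : Type} (X : I -> T -> R) : (T -> R) -> Prop :=
| polyfun_cst c : polyfun X (cst c)
| polyfun_gen i : polyfun X (X i)
| polyfun_add f g : polyfun X f -> polyfun X g -> polyfun X (fun x => f x + g x)
| polyfun_mul f g : polyfun X f -> polyfun X g -> polyfun X (fun x => f x * g x).

(** Restricting a function to a coordinate line is a composition of this kind, where
    each X i composed with h is a coordinate of the line or a constant. *)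
Lemma polyfun_comp T I (X : I -> T -> R) S J (Y : J -> S -> R) (h : S -> T) f :
  (forall i, polyfun Y (X i \o h)) -> polyfun X f -> polyfun Y (f \o h).
Proof.
move=> Xh; elim=> {f}[c|i|f g _ ? _ ?|f g _ ? _ ?]; [exact: polyfun_cst|exact: Xh| |].
  exact: (@polyfun_add _ _ _ (f \o h) (g \o h)).
exact: (@polyfun_mul _ _ _ (f \o h) (g \o h)).
Qed.

Lemma polyfun_measurable dT (T : measurableType dT) I (X : I -> T -> R) f :
  (forall i, measurable_fun setT (X i)) -> polyfun X f -> measurable_fun setT f.
Proof.
move=> mX; elim=> {f}[c|i|f g _ ? _ ?|f g _ ? _ ?]//.
  exact: measurable_funD.
exact: measurable_funM.
Qed.

Section algebra.
Context {T I : Type} (X : I -> T -> R).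

Lemma polyfun_opp f : polyfun X f -> polyfun X (fun x => - f x).
Proof.
move=> Xf; rewrite (_ : (fun _ => _) = (fun x => cst (-1) x * f x)).
  by apply: polyfun_mul => //; exact: polyfun_cst.
by apply/funext => x; rewrite /= mulN1r.
Qed.

Lemma polyfun_sub f g : polyfun X f -> polyfun X g -> polyfun X (fun x => f x - g x).
Proof. by move=> Xf Xg; apply: polyfun_add => //; exact: polyfun_opp. Qed.

Lemma polyfun_sum J (r : seq J) (P : pred J) (f : J -> T -> R) :
  (forall i, P i -> polyfun X (f i)) ->
  polyfun X (fun x => \sum_(i <- r | P i) f i x).
Proof.
move=> Xf; elim: r => [|j r IH].
  rewrite (_ : (fun _ => _) = cst 0) ; first exact: polyfun_cst.
  by apply/funext => x; rewrite big_nil.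
case Pj: (P j); last first.
  by rewrite (_ : (fun _ => _) = (fun x => \sum_(i <- r | P i) f i x))//;
    apply/funext => x; rewrite big_cons Pj.
rewrite (_ : (fun _ => _) = (fun x => f j x + \sum_(i <- r | P i) f i x)).
  by apply: polyfun_add => //; exact: Xf.
by apply/funext => x; rewrite big_cons Pj.
Qed.

Lemma polyfun_prod J (r : seq J) (P : pred J) (f : J -> T -> R) :
  (forall i, P i -> polyfun X (f i)) ->
  polyfun X (fun x => \prod_(i <- r | P i) f i x).
Proof.
move=> Xf; elim: r => [|j r IH].
  rewrite (_ : (fun _ => _) = cst 1) ; first exact: polyfun_cst.
  by apply/funext => x; rewrite big_nil.
case Pj: (P j); last first.
  by rewrite (_ : (fun _ => _) = (fun x => \prod_(i <- r | P i) f i x))//;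
    apply/funext => x; rewrite big_cons Pj.
rewrite (_ : (fun _ => _) = (fun x => f j x * \prod_(i <- r | P i) f i x)).
  by apply: polyfun_mul => //; exact: Xf.
by apply/funext => x; rewrite big_cons Pj.
Qed.

Lemma polyfun_sqr f : polyfun X f -> polyfun X (fun x => f x ^+ 2).
Proof. by move=> Xf; exact: polyfun_mul. Qed.

Lemma polyfun_det n (M : T -> 'M[R]_n) : (forall i j, polyfun X (fun x => M x i j)) ->
  polyfun X (fun x => \det (M x)).
Proof.
move=> XM; apply: polyfun_sum => s _; apply: polyfun_mul; first exact: polyfun_cst.
by apply: polyfun_prod => i _; exact: XM.
Qed.

Lemma polyfun_adj n (M : T -> 'M[R]_n) i j : (forall i j, polyfun X (fun x => M x i j)) ->
  polyfun X (fun x => (\adj (M x)) i j).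
Proof.
move=> XM; rewrite (_ : (fun _ => _) = (fun x => cofactor (M x) j i)); last first.
  by apply/funext => x; rewrite mxE.
apply: polyfun_mul; first exact: polyfun_cst.
apply: polyfun_det => k l; rewrite (_ : (fun _ => _) = (fun x => M x (lift j k) (lift i l)))//.
by apply/funext => x; rewrite !mxE.
Qed.

End algebra.

Definition pt_coord n (i : 'I_n) (x : Rn R n) : R := tnth x i.

Definition tuple_coord m n (ij : 'I_m * 'I_n) (a : m.-tuple (Rn R n)) : R :=
  tnth (tnth a ij.1) ij.2.

Lemma polyfun_poly (f : measurableTypeR R -> R) : polyfun (fun _ : unit => idfun) f ->
  exists p : {poly R}, f = horner p.
Proof.
elim=> {f}[c|i|f g _ [p ->] _ [q ->]|f g _ [p ->] _ [q ->]].
- by exists c%:P; apply/funext => x; rewrite hornerC.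
- by exists 'X; apply/funext => x; rewrite hornerX.
- by exists (p + q); apply/funext => x; rewrite hornerD.
- by exists (p * q); apply/funext => x; rewrite hornerM.
Qed.

Lemma thin_poly (f : measurableTypeR R -> R) : polyfun (fun _ : unit => idfun) f ->
  thin (@lebesgue_measure R) f.
Proof.
move=> /polyfun_poly[p ->]; have [->|p0] := eqVneq p 0.
  by left=> x; rewrite horner0.
right; apply: countable_lebesgue_measure0; apply: finite_set_countable.
apply: contrapT => /(@infinite_set_fset _ _ (size p))[X XA].
rewrite leqNgt => /negP; apply; apply: max_poly_roots => //.
  by apply/allP => x xX; apply/eqP/XA.
exact: finmap.fset_uniq.
Qed.

(** The product structure is used at two levels: first for a point of R^n over the
    real line, where a nonzero polynomial has finitely many roots, then for a tuple
    over R^n. *)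
Lemma null_zero_polyfun m n (f : m.-tuple (Rn R n) -> R) p :
  polyfun (@tuple_coord m n) f -> f p != 0 -> null_tuples [set a | f a = 0].
Proof.
move=> Xf fp.
have mcoord k : measurable_fun setT (@pt_coord n k) by exact: measurable_tnth.
have mcoord2 ij : measurable_fun setT (@tuple_coord m n ij).
  exact: (measurableT_comp (mcoord ij.2)
           (measurable_tnth ij.1 : measurable_fun setT (fun a : m.-tuple (Rn R n) => _))).
have thinC g : polyfun (@pt_coord n) g -> thin (@lebesgue_Rn R n) g.
  move=> Xg.
  apply: (@thin_tuple _ (measurableTypeR R) (@lebesgue_measure R)
    (polyfun (fun _ : unit => idfun))).
  - by move=> h; apply: polyfun_measurable => _; exact: measurable_id.
  - exact: thin_poly.
  - exact: polyfun_measurable Xg.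
  - move=> x i; apply: polyfun_comp Xg => j.
    have [->|ji] := eqVneq j i.
      rewrite (_ : _ \o _ = idfun); first exact: (polyfun_gen _ tt).
      by apply/funext => t; rewrite /= /pt_coord tnth_tupd eqxx.
    rewrite (_ : _ \o _ = cst (tnth x j)); first exact: polyfun_cst.
    by apply/funext => t; rewrite /= /pt_coord tnth_tupd (negbTE ji).
have [f0|f0] : thin (tuple_measure (@lebesgue_Rn R n) m) f.
- apply: (@thin_tuple _ _ _ (polyfun (@pt_coord n))) => //.
  - by move=> h; exact: polyfun_measurable.
  - exact: polyfun_measurable Xf.
  - move=> x i; apply: polyfun_comp Xf => -[j k].
    have [->|ji] := eqVneq j i.
      rewrite (_ : _ \o _ = pt_coord k); first exact: polyfun_gen.
      by apply/funext => t; rewrite /= /tuple_coord/= tnth_tupd eqxx.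
    rewrite (_ : _ \o _ = cst (tuple_coord (j, k) x)); first exact: polyfun_cst.
    by apply/funext => t; rewrite /= /tuple_coord/= tnth_tupd (negbTE ji).
- by rewrite f0 eqxx in fp.
exists [set a | f a = 0]; split => //.
by apply: measurable_zeros; exact: polyfun_measurable Xf.
Qed.

Lemma negligible_countable {dT} {T : measurableType dT}
    (mu : {measure set T -> \bar R}) I (D : set I) (F : I -> set T) :
  countable D -> (forall i, D i -> mu.-negligible (F i)) ->
  mu.-negligible (\bigcup_(i in D) F i).
Proof.
move=> /countable_injP[g ginj] F0.
rewrite (_ : \bigcup_(i in D) F i =
    \bigcup_n \bigcup_(i in D `&` [set i | g i = n]) F i); last first.
  apply/seteqP; split=> [x [i Di Fi]|x [n _ [i [Di _] Fi]]]; last by exists i.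
  by exists (g i) => //; exists i.
apply: negligible_bigcup => n.
have [[i [Di gi]]|nD] := pselect (exists i, D i /\ g i = n).
  apply: negligibleS (F0 _ Di) => x [j [Dj gj] Fj].
  by rewrite (ginj i j) ?inE ?gi ?gj.
rewrite (_ : \bigcup_(_ in _) _ = set0); first exact: negligible_set0.
by rewrite -subset0 => x [i [Di gi] _]; apply: nD; exists i.
Qed.

(** Such a family records the distances from one point to the entries of a tuple. *)
Lemma countable_families (Z : set R) m :
  countable Z -> countable [set r : 'I_m -> R | forall i, Z (r i)].
Proof.
move=> /countable_injP[g ginj]; apply/countable_injP.
exists (fun r => pickle [tuple g (r i) | i < m]) => r s; rewrite !inE => Zr Zs.
move=> /(pcan_inj pickleK) rs; apply/funext => i; apply: ginj; rewrite ?inE//.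
by have := congr1 (fun t => tnth t i) rs; rewrite !tnth_mktuple.
Qed.

End null_zero_sets.

(** * Shears preserve Lebesgue measure *)
Section measure_preserving.
Context {R : realType}.

Lemma lebesgue_measure_translate (c : R) (A : set (measurableTypeR R)) :
  measurable A -> lebesgue_measure [set x : measurableTypeR R | A (x + c)] = lebesgue_measure A.
Proof.
move=> mA; pose f : measurableTypeR R -> measurableTypeR R := fun x => x + c.
have mf : measurable_fun setT f by exact: measurable_funD.
apply/esym/(@lebesgue_measure_unique _ (pushforward lebesgue_measure f)) => //.
move=> _ [[a b]] _ <-.
transitivity (lebesgue_measure (`](a - c), (b - c)]%classic : set (measurableTypeR R))).
  rewrite !lebesgue_measure_itv/= !lte_fin ltrD2r; case: ifP => // _.
  by congr (_%:E); rewrite opprB addrA subrK.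
congr (lebesgue_measure _).
by apply/seteqP; split => x; rewrite /f /= !in_itv/= ltrBlDr lerBrDr.
Qed.

Section tuple_fubini2.
Context {dT : measure_display} {T : measurableType dT}.
Variable mu : {sigma_finite_measure set T -> \bar R}.

(** Slicing with the first coordinate innermost, which is the order of integration
    adapted to a shear along the first coordinate. *)
Lemma tuple_measureSE2 n (A : set (n.+1.-tuple T)) : measurable A ->
  tuple_measure mu n.+1 A =
  (\int[tuple_measure mu n]_t mu [set x : T | A (tuple_cons (x, t))])%E.
Proof.
move=> mA; rewrite /= /tuple_measure_step /pushforward.
have mB : measurable (tuple_cons @^-1` A : set (T * n.-tuple T)).
  by rewrite -[X in measurable X]setTI; exact: measurable_tuple_cons.
rewrite (@product_measure_unique _ _ _ _ _ _ _ (mu \x^ tuple_measure mu n)%E _ _ mB);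
  last by move=> B C mB' mC; exact: product_measure2E.
rewrite /= /product_measure2 /=.
apply: eq_integral => x _ /=; congr (_ _).
by apply/seteqP; split => y; rewrite /ysection /= /tuple_cons/= inE.
Qed.

End tuple_fubini2.

Definition vol_preserving n (f : Rn R n -> Rn R n) :=
  measurable_fun setT f /\
  forall A, measurable A -> lebesgue_Rn (f @^-1` A) = lebesgue_Rn A.

Lemma vol_preserving_comp n (f g : Rn R n -> Rn R n) :
  vol_preserving f -> vol_preserving g -> vol_preserving (f \o g).
Proof.
move=> [mf pf] [mg pg]; split; first exact: measurableT_comp.
move=> A mA; rewrite comp_preimage pg ?pf//.
by rewrite -[X in measurable X]setTI; exact: mf.
Qed.

Lemma tupd_cons0 n (y : R) (t : Rn R n) v :
  tupd (tuple_cons (y : measurableTypeR R, t)) ord0 v = tuple_cons (v, t).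
Proof.
apply: eq_from_tnth => j; rewrite tnth_tupd.
by case: (unliftP ord0 j) => [k ->|->]; rewrite ?tnth0//= !tnthS.
Qed.

Lemma tupd_consS n (y : R) (t : Rn R n) k v :
  tupd (tuple_cons (y : measurableTypeR R, t)) (lift ord0 k) v =
  tuple_cons (y : measurableTypeR R, tupd t k v).
Proof.
apply: eq_from_tnth => j; rewrite tnth_tupd.
case: (unliftP ord0 j) => [i ->|->]; rewrite ?tnth0//= !tnthS tnth_tupd.
by rewrite (inj_eq lift_inj).
Qed.

Lemma measurable_tupd n (i : 'I_n) (g : Rn R n -> measurableTypeR R) :
  measurable_fun setT g -> measurable_fun setT (fun x => tupd x i (g x)).
Proof.
move=> mg; apply/measurable_fun_tnthP => j.
rewrite (_ : _ \o _ = if j == i then g else (@tnth _ _)^~ j).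
  by case: ifP => // _; exact: measurable_tnth.
by apply/funext => x; rewrite /= tnth_tupd; case: ifP.
Qed.

(** On each line parallel to the axis i the map is a translation, since g does not
    depend on the coordinate i. The induction on n brings that axis into first
    position, where Fubini and translation invariance on R apply. *)
Lemma vol_preserving_shear n (i : 'I_n) (g : Rn R n -> measurableTypeR R) :
  measurable_fun setT g -> (forall x t, g (tupd x i t) = g x) ->
  vol_preserving (fun x => tupd x i ((tnth x i : R) + g x)).
Proof.
move=> mg gi; split.
  by apply: measurable_tupd; apply: measurable_funD => //; exact: measurable_tnth.
elim: n i g mg gi => [[]//|n IH] i g mg gi A mA.
have mpA : measurable ((fun x => tupd x i ((tnth x i : R) + g x)) @^-1` A).
  rewrite -[X in measurable X]setTI; apply: measurable_tupd => //.
  by apply: measurable_funD => //; exact: measurable_tnth.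
case: (unliftP ord0 i) => [k ik|i0]; last first.
  rewrite /lebesgue_Rn !tuple_measureSE2//; apply: eq_integral => t _.
  apply: etrans (lebesgue_measure_translate (g (tuple_cons (0 : measurableTypeR R, t))) _);
    last first.
    rewrite -[X in measurable X]setTI.
    exact: (measurableT_comp measurable_tuple_cons (measurable_pair2 t)).
  congr (lebesgue_measure _); apply/seteqP; split=> x /=; rewrite i0 tupd_cons0 tnth0/=.
    by rewrite -(gi _ 0) i0 tupd_cons0.
  by rewrite -[in X in _ -> X](gi _ 0) i0 tupd_cons0.
rewrite /lebesgue_Rn !tuple_measureSE; apply: eq_integral => y _.
rewrite -[RHS](IH k (fun t => g (tuple_cons (y : measurableTypeR R, t)))).
- congr (_ _); apply/seteqP; split=> x /=; rewrite ik tupd_consS tnthS//=.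
- by apply: measurableT_comp => //; exact: measurable_consr.
- by move=> x t; rewrite -tupd_consS -ik gi.
- exact: measurable_tuple_section.
Qed.

Lemma vol_preserving_Rintegral n (f : Rn R n -> Rn R n) B (h : Rn R n -> R) : vol_preserving f ->
  measurable B -> f @^-1` B = B -> measurable_fun setT h ->
  \int[lebesgue_Rn]_(x in B) h (f x) = \int[lebesgue_Rn]_(x in B) h x.
Proof.
move=> [mf pf] mB fB mh; rewrite /Rintegral; congr fine.
have ge0 (k : Rn R n -> \bar R) : measurable_fun setT k -> (forall x, 0 <= k x)%E ->
    (\int[lebesgue_Rn]_(x in B) (k \o f) x = \int[lebesgue_Rn]_(x in B) k x)%E.
  move=> mk k0; rewrite -[in LHS]fB -ge0_integral_pushforward//.
    by apply: eq_measure_integral => /= A mA _; exact: pf.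
  exact: measurable_funTS.
have mEh : measurable_fun setT (EFin \o h) by exact/measurable_EFinP.
rewrite (_ : (fun x => (h (f x))%:E) = (EFin \o h) \o f)//.
rewrite integralE [RHS]integralE funepos_comp funeneg_comp !ge0//.
  exact: measurable_funeneg.
exact: measurable_funepos.
Qed.

End measure_preserving.

(** * Rotations, and reduction to the first axis *)
Section rotations.
Context {R : realType}.

Definition plane_rot n (i j : 'I_n) (c s : R) (x : Rn R n) : Rn R n :=
  tupd (tupd x i (c * tnth x i + s * tnth x j : R)) j (c * tnth x j - s * tnth x i : R).

Lemma dotp_split n (i j : 'I_n) (x y : Rn R n) : i != j ->
  dotp x y = tnth x i * tnth y i + tnth x j * tnth y j +
    \sum_(k < n | (k != i) && (k != j)) (tnth x k : R) * tnth y k.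
Proof.
by move=> ij; rewrite /dotp (bigD1 i)//= (bigD1 j) ?(eq_sym j)//= addrA.
Qed.

Lemma dotp_plane_rot n (i j : 'I_n) c s (x y : Rn R n) : i != j -> c ^+ 2 + s ^+ 2 = 1 ->
  dotp (plane_rot i j c s x) (plane_rot i j c s y) = dotp x y.
Proof.
move=> ij cs; rewrite !(dotp_split _ _ ij) !tnth_tupd !eqxx (negbTE ij).
congr (_ + _).
  transitivity ((c ^+ 2 + s ^+ 2) * (tnth x i * tnth y i + tnth x j * tnth y j) : R).
    by ring.
  by rewrite cs mul1r.
by apply: eq_bigr => k /andP[ki kj]; rewrite !tnth_tupd (negbTE ki) (negbTE kj).
Qed.

(** A plane rotation of angle theta is the product of three shears with coefficients
    tan(theta/2), -sin(theta), tan(theta/2); here tan(theta/2) is written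
    (1 - c) / s. *)
Lemma vol_preserving_plane_rot n (i j : 'I_n) c s : i != j -> c ^+ 2 + s ^+ 2 = 1 -> s != 0 ->
  vol_preserving (plane_rot i j c s).
Proof.
move=> ij cs s0.
pose sh k l a (x : Rn R n) : Rn R n :=
  tupd x k ((tnth x k : R) + (a * tnth x l)).
have msh k l a : k != l -> vol_preserving (sh k l a).
  move=> kl; apply: (@vol_preserving_shear _ _ k (fun x => a * tnth x l)).
    by apply: measurable_funM => //; exact: measurable_tnth.
  by move=> x t; rewrite tnth_tupd eq_sym (negbTE kl).
rewrite (_ : plane_rot i j c s = sh i j ((1 - c) / s) \o (sh j i (- s) \o sh i j ((1 - c) / s))).
  by apply: vol_preserving_comp; [|apply: vol_preserving_comp]; apply: msh; rewrite // eq_sym.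
apply/funext => x; apply: eq_from_tnth => k /=; rewrite !tnth_tupd !eqxx.
rewrite (negbTE ij) !(eq_sym j) (negbTE ij).
have [->|kj] := eqVneq k j.
  rewrite eq_sym (negbTE ij); by field.
have [_|//] := eqVneq k i.
have -> : s * tnth x j = (1 - c ^+ 2) / s * tnth x j.
  by rewrite -cs (_ : c ^+ 2 + s ^+ 2 - c ^+ 2 = s * s) ?mulfK//; ring.
by field.
Qed.

Lemma measurable_dotp n (y : Rn R n) :
  measurable_fun setT (fun x : Rn R n => dotp x y).
Proof.
apply: polyfun_measurable (@pt_coord R n) _ _ _; first by move=> i; exact: measurable_tnth.
apply: polyfun_sum => i _; apply: polyfun_mul; [exact: (polyfun_gen _ i)|exact: polyfun_cst].
Qed.

Lemma measurable_normsq n : measurable_fun setT (fun x : Rn R n => dotp x x).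
Proof.
apply: polyfun_measurable (@pt_coord R n) _ _ _; first by move=> i; exact: measurable_tnth.
apply: polyfun_sum => i _; apply: polyfun_mul; exact: (polyfun_gen _ i).
Qed.

Lemma dotp_ge0 n (x : Rn R n) : 0 <= dotp x x.
Proof. by apply: sumr_ge0 => i _; rewrite -expr2 sqr_ge0. Qed.

Lemma unit_ballE n : unit_ball R n = [set x | dotp x x <= 1].
Proof.
rewrite /unit_ball; apply/funext => x /=; apply/propext.
by rewrite /enorm -[X in _ <= X](@sqrtr1 R) ler_sqrt.
Qed.

Lemma measurable_ball n (q : R) : measurable [set x : Rn R n | dotp x x <= q].
Proof.
rewrite (_ : [set _ | _] = setT `&` (fun x : Rn R n => dotp x x) @^-1` `]-oo, q]).
  by apply: measurable_normsq => //; exact: measurable_itv.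
by rewrite setTI; apply/seteqP; split => x /=; rewrite in_itv.
Qed.

(** The linear forms x.e and x.f have the same distribution on the unit ball. *)
Definition same_profile n (e f : Rn R n) := forall phi : R -> R, measurable_fun setT phi ->
  \int[lebesgue_Rn]_(x in unit_ball R n) phi (dotp x e) =
  \int[lebesgue_Rn]_(x in unit_ball R n) phi (dotp x f).

Lemma same_profile_plane_rot n (i j : 'I_n) c s e : i != j -> c ^+ 2 + s ^+ 2 = 1 -> s != 0 ->
  same_profile e (plane_rot i j c s e).
Proof.
move=> ij cs s0 phi mphi.
under eq_Rintegral do rewrite -(dotp_plane_rot _ _ ij cs).
rewrite (vol_preserving_Rintegral (h := fun x => phi (dotp x (plane_rot i j c s e))))//.
- exact: vol_preserving_plane_rot.
- by rewrite unit_ballE; exact: measurable_ball.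
- by rewrite unit_ballE; apply/seteqP; split=> x /=; rewrite dotp_plane_rot.
- by apply: measurableT_comp => //; exact: measurable_dotp.
Qed.

Definition axis n (r : R) : Rn R n.+1 :=
  tuple_cons (r : measurableTypeR R, [tuple (0 : measurableTypeR R) | _ < n]).

Lemma dotp_axis n (x : Rn R n.+1) r : dotp x (axis n r) = r * tnth x ord0.
Proof.
rewrite /dotp big_ord_recl big1 => [|i _]; first by rewrite tnth0 addr0 mulrC.
by rewrite tnthS tnth_mktuple mulr0.
Qed.

(** The coordinates of e other than the first are cancelled one after the other by
    rotations in the planes that they span with the first axis. *)
Lemma same_profile_axis n (e : Rn R n.+1) :
  exists2 r : R, r ^+ 2 = dotp e e & same_profile e (axis n r).
Proof.
have [f [fe ef f0]] : exists f, [/\ dotp f f = dotp e e, same_profile e f &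
    forall k : 'I_n.+1, (0 < k <= n)%N -> tnth f k = 0 :> R].
  suff : forall m, (m <= n)%N -> exists f, [/\ dotp f f = dotp e e, same_profile e f &
    forall k : 'I_n.+1, (0 < k <= m)%N -> tnth f k = 0 :> R] by exact.
  elim=> [_|m IH mn]; first by exists e; split=> // k; case: ltngtP.
  have [f [fe ef f0]] := IH (ltnW mn).
  pose j : 'I_n.+1 := @Ordinal n.+1 m.+1 mn.
  have [fj|fj] := eqVneq (tnth f j : R) 0.
    exists f; split => // k /andP[k0]; rewrite leq_eqVlt => /orP[/eqP km|km].
      by rewrite (_ : k = j)//; exact/val_inj.
    by apply: f0; rewrite k0.
  have ij : ord0 != j by [].
  pose r := Num.sqrt ((tnth f ord0 : R) ^+ 2 + (tnth f j : R) ^+ 2).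
  have r2 : r ^+ 2 = (tnth f ord0 : R) ^+ 2 + (tnth f j : R) ^+ 2.
    by rewrite sqr_sqrtr// addr_ge0// sqr_ge0.
  have r0 : r != 0.
    rewrite -sqrf_eq0 r2 paddr_eq0 ?sqr_ge0// !sqrf_eq0 (negbTE fj) andbF//.
  have cs : ((tnth f ord0 : R) / r) ^+ 2 + ((tnth f j : R) / r) ^+ 2 = 1.
    by rewrite !expr_div_n -mulrDl -r2 divff// expf_neq0.
  exists (plane_rot ord0 j ((tnth f ord0 : R) / r) ((tnth f j : R) / r) f); split.
  - by rewrite dotp_plane_rot.
  - move=> phi mphi; rewrite ef//; apply: same_profile_plane_rot => //.
    by rewrite mulf_neq0// invr_neq0.
  - move=> k /andP[k0 km]; rewrite !tnth_tupd.
    have [kj|kj] := eqVneq k j; first by ring.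
    rewrite (_ : k == ord0 = false); last by apply/negbTE; rewrite -lt0n.
    by apply: f0; rewrite k0 -ltnS ltn_neqAle km andbT.
have fE : f = axis n (tnth f ord0).
  apply: eq_from_tnth => k; case: (unliftP ord0 k) => [l ->|->]; last by rewrite tnth0.
  by rewrite tnthS tnth_mktuple f0//= /bump/= add1n ltnS.
rewrite fE in ef; exists (tnth f ord0) => //.
by rewrite -fe [X in dotp _ X]fE dotp_axis expr2.
Qed.

(** A half turn, as two quarter turns. It makes the integral over the ball of any odd
    function of x.e vanish. *)
Lemma same_profile_axisN n (r : R) : same_profile (axis n.+1 r) (axis n.+1 (- r)).
Proof.
have ij : (ord0 : 'I_n.+2) != lift ord0 ord0 by [].
have cs : 0 ^+ 2 + 1 ^+ 2 = 1 :> R by rewrite expr0n expr1n add0r.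
move=> phi mphi.
rewrite (same_profile_plane_rot _ ij cs (oner_neq0 _))//
  (same_profile_plane_rot _ ij cs (oner_neq0 _))//.
congr (Rintegral _ _ _); apply/funext => x; congr (phi (dotp x _)).
apply: eq_from_tnth => k; case: (unliftP ord0 k) => [l ->|->]; last first.
  by rewrite !tnth_tupd !eqxx/= tnthS tnth_mktuple !tnth0/=; ring.
rewrite !tnth_tupd !eqxx/= !(inj_eq lift_inj) !tnthS !tnth_mktuple !tnth0.
by have [_|_] := eqVneq l ord0; rewrite ?eqxx/=; ring.
Qed.

End rotations.

(** * Zeros of solutions of a Bessel-type equation *)
(** Differentiation rules for functions written with a bound variable. The derivative is
    synthesized from the shape of the function, and der_eq compares it with the expected
    one. *)
Section calculus.
Context {R : realType}.
Implicit Types (f g : R -> R) (x a b : R).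

Lemma der_eq f x a b : is_derive x 1 f a -> a = b -> is_derive x 1 f b.
Proof. by move=> ? <-. Qed.

Lemma der_cst c x : is_derive x 1 (fun _ : R => c : R) (0 : R).
Proof. exact: is_derive_cst. Qed.

Lemma der_id x : is_derive x (1 : R) (fun y : R => y : R) (1 : R).
Proof. exact: is_derive_id. Qed.

Lemma derD f g x a b : is_derive x 1 f a -> is_derive x 1 g b ->
  is_derive x 1 (fun y => f y + g y) (a + b).
Proof. by move=> fa gb; exact: (@is_deriveD _ _ _ f g). Qed.

Lemma derB f g x a b : is_derive x 1 f a -> is_derive x 1 g b ->
  is_derive x 1 (fun y => f y - g y) (a - b).
Proof. by move=> fa gb; exact: (@is_deriveB _ _ _ f g). Qed.

Lemma derM f g x a b : is_derive x 1 f a -> is_derive x 1 g b ->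
  is_derive x 1 (fun y => f y * g y) (a * g x + f x * b).
Proof.
move=> fa gb; apply: (der_eq (@is_deriveM _ _ f g _ _ _ _ fa gb)).
by rewrite addrC [a * _]mulrC.
Qed.

Lemma derX f n x a : is_derive x 1 f a ->
  is_derive x 1 (fun y => f y ^+ n) (n%:R * f x ^+ n.-1 * a).
Proof.
move=> fa; elim: n => [|n IH].
  by apply: der_eq (der_cst 1 x) _; rewrite mul0r mul0r.
rewrite (_ : (fun _ => _) = fun y => f y * f y ^+ n); last first.
  by apply/funext => y; rewrite exprS.
apply: der_eq (derM fa IH) _; case: n {IH} => [|n /=]; first by rewrite !expr0; ring.
by rewrite exprS -[n.+2]addn1 natrD; ring.
Qed.

Lemma der_comp f g x a b : is_derive x 1 f a -> is_derive (f x) 1 g b ->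
  is_derive x 1 (fun y => g (f y)) (b * a).
Proof. move=> fa gb; exact: (@is_derive1_comp _ g f x b a gb fa). Qed.

Lemma derV f x a : f x != 0 -> is_derive x 1 f a ->
  is_derive x 1 (fun y => (f y)^-1) (- (f x ^- 2) * a).
Proof. by move=> fx fa; apply: der_eq (is_deriveV fx fa) _. Qed.

Lemma der_continuous f x a : is_derive x 1 f a -> {for x, continuous f}.
Proof. by case=> df _; apply/differentiable_continuous/derivable1_diffP. Qed.

Lemma der_sqrtX f n x a : 0 < f x -> is_derive x 1 f a ->
  is_derive x 1 (fun y => Num.sqrt (f y) ^+ n.+2) (n.+2%:R / 2 * Num.sqrt (f x) ^+ n * a).
Proof.
move=> f0 fa; apply: der_eq (derX n.+2 (der_comp fa (is_derive1_sqrt f0))) _.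
have s0 : Num.sqrt (f x) != 0 by rewrite gt_eqF// sqrtr_gt0.
by rewrite /= exprS; field.
Qed.

Lemma cos_norm x : `|cos x| <= 1.
Proof. by rewrite ler_norml cos_geN1 cos_le1. Qed.

Lemma sin_norm x : `|sin x| <= 1.
Proof. by rewrite ler_norml sin_geN1 sin_le1. Qed.

Lemma mean_value f df x y : x < y ->
  (forall z, x <= z <= y -> is_derive z 1 f (df z)) ->
  exists2 c, x < c < y & f y - f x = df c * (y - x).
Proof.
move=> xy dfz; have [||c] := @MVT R f df x y xy.
- by move=> z; rewrite in_itv/= => /andP[xz zy]; apply: dfz; rewrite !ltW.
- apply: continuous_in_subspaceT => z; rewrite inE/= in_itv/= => xzy.
  exact: der_continuous (dfz z xzy).
- by rewrite in_itv/=; exists c.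
Qed.

End calculus.

(** The equation k (g + g'') = - D g' is the one satisfied by k^(-nu) J_nu(k) with
    nu = (D - 1) / 2. *)
Section bessel.
Context {R : realType}.
Variables (g g1 g2 : R -> R) (D : nat).
Hypothesis D0 : (0 < D)%N.
Hypothesis dg : forall k : R, is_derive k 1 g (g1 k).
Hypothesis dg1 : forall k : R, is_derive k 1 g1 (g2 k).
Hypothesis ode : forall k, k * (g k + g2 k) = - D%:R * g1 k.

Let g_cont : continuous g.
Proof. by move=> k; exact: der_continuous (dg k). Qed.

(** The energy (g^2 + g'^2) k^(2D) is nondecreasing on k >= 0, because its derivative
    is 2 D g^2 k^(2D-1). If g and g' both vanished at k, the energy would be zero on
    [0,k], so g would be zero there, against g(0) <> 0. *)
Lemma bessel_simple_zero (k : R) : g 0 != 0 -> 0 < k -> g k = 0 -> g1 k != 0.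
Proof.
move=> g0 k0 gk; apply/eqP => g1k.
pose E x := (g x ^+ 2 + g1 x ^+ 2) * x ^+ (2 * D).
pose dE x := 2%:R * D%:R * g x ^+ 2 * x ^+ (2 * D).-1.
have dEx (x : R) : is_derive x 1 E (dE x).
  apply: der_eq (derM (derD (derX 2 (dg x)) (derX 2 (dg1 x))) (derX (2 * D) (der_id x))) _.
  rewrite /dE /= !expr1 mulr1.
  have -> : x ^+ (2 * D) = x * x ^+ (2 * D).-1 by rewrite -exprS prednK// muln_gt0.
  transitivity ((2 * g1 x * (x * (g x + g2 x)) + (2 * D)%:R * (g x ^+ 2 + g1 x ^+ 2))
      * x ^+ (2 * D).-1); first by ring.
  by rewrite ode natrM; ring.
have gz x : 0 < x < k -> g x = 0.
  move=> /andP[x0 xk]; have [c /andP[xc ck] Ec] := mean_value xk (fun z _ => dEx z).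
  have E0 : E x <= 0.
    have -> : E x = E k - (E k - E x) by rewrite subKr.
    rewrite Ec /E gk g1k expr0n/= addr0 mul0r sub0r oppr_le0 mulr_ge0 ?subr_ge0 ?(ltW xk)//.
    have c0 : 0 <= c by rewrite ltW// (lt_trans x0).
    by apply: mulr_ge0; rewrite ?exprn_ge0// mulr_ge0 ?sqr_ge0//.
  apply/eqP; rewrite -sqrf_eq0 eq_le sqr_ge0 andbT.
  apply: le_trans (_ : g x ^+ 2 + g1 x ^+ 2 <= 0); first by rewrite lerDl sqr_ge0.
  by move: E0; rewrite /E pmulr_lle0// exprn_gt0.
have [e /= e0 He] : nbhs_ball (0 : R) (fun x => g x != 0).
  by apply/nbhs_ballP; exact: (@cvgr_neq0 R R R (nbhs (0 : R)) _ g (g 0) (@g_cont 0) g0).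
(* A point of ]0, k[ close enough to 0 for g not to vanish there. *)
pose x := Num.min (e / 2) (k / 2).
have x0 : 0 < x by rewrite /x lt_min !divr_gt0.
have xk : x < k by rewrite /x gt_min (_ : k / 2 < k) ?orbT//; lra.
have xe : x < e by rewrite /x gt_min (_ : e / 2 < e)//; lra.
have /eqP[] : g x != 0 by apply: He; rewrite /ball/= sub0r normrN gtr0_norm.
by apply: gz; rewrite x0.
Qed.

(** Sturm comparison. The function u = k^(D/2) g satisfies u'' = - q u with
    q = 1 - D (D - 2) / (4 k^2) >= 1/4 for k >= D, whereas v = sin((k - k1)/2), which
    is positive inside the interval, satisfies v'' = - v / 4. Hence the Wronskian
    u' v - u v' does not increase; but it goes from - u(k1) / 2 to
    u(k1 + 2 pi) / 2. *)
Lemma bessel_no_positive_arch (k1 : R) : (2 <= D)%N -> D%:R <= k1 ->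
  ~ (forall k, k1 <= k <= k1 + 2 * pi -> 0 < g k).
Proof.
move=> D2 Dk1 gpos.
have pi0 := pi_gt0 R.
have D0' : 0 < D%:R :> R by rewrite ltr0n.
pose y x : R := (x - k1) / 2.
have dy (x : R) : is_derive x 1 y (1 / 2).
  by apply: der_eq (derM (derB (der_id x) (der_cst k1 x)) (der_cst 2^-1 x)) _; ring.
pose v x := sin (y x); pose v1 x := cos (y x) / 2.
have dv (x : R) : is_derive x 1 v (v1 x).
  by apply: der_eq (der_comp (dy x) (is_derive_sin _)) _; rewrite mulrA mulr1.
have dv1 (x : R) : is_derive x 1 v1 (- v x / 4).
  apply: der_eq (derM (der_comp (dy x) (is_derive_cos _)) (der_cst 2^-1 x)) _.
  by rewrite /v; field.
pose B x := (g1 x + D%:R / 2 * x^-1 * g x) * v x - g x * v1 x.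
pose P (x : R) := Num.sqrt x ^+ D.
(* The derivative of the Wronskian, which is k^(D/2) B once u' is written
   k^(D/2) (g' + D / (2k) g). *)
pose dW (x : R) := - (3 / 4 - D%:R * (D%:R - 2) / (4 * x ^+ 2)) * (P x * (g x * v x)).
have dWx (x : R) : 0 < x -> is_derive x 1 (fun x => P x * B x) (dW x).
  move=> x0; have xn0 : x != 0 by rewrite gt_eqF.
  have dP : is_derive x 1 P (D%:R / 2 * Num.sqrt x ^+ (D - 2) * 1).
    rewrite /P; move: D2; case: (D) => [|[|m]]// _.
    by rewrite subSS subn1/=; exact: (der_sqrtX m x0 (der_id x)).
  have dB : is_derive x 1 B ((g2 x + (D%:R / 2 * (- x ^- 2) * g x + D%:R / 2 * x^-1 * g1 x)) * v x
      + (g1 x + D%:R / 2 * x^-1 * g x) * v1 x - (g1 x * v1 x + g x * (- v x / 4))).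
    apply: der_eq (derB (derM (derD (dg1 x) (derM (derM (der_cst (D%:R / 2) x)
      (derV xn0 (der_id x))) (dg x))) (dv x)) (derM (dg x) (dv1 x))) _.
    by rewrite mul0r add0r mulr1.
  apply: der_eq (derM dP dB) _.
  have s0 : Num.sqrt x != 0 by rewrite gt_eqF// sqrtr_gt0.
  have -> : g2 x = - D%:R * g1 x / x - g x.
    by apply: (mulfI xn0); rewrite mulrBr [x * (_ / x)]mulrC divfK// -ode; ring.
  have PE : P x = Num.sqrt x ^+ (D - 2) * x.
    by rewrite -[X in _ * X](@sqr_sqrtr _ x) ?ltW// -exprD subnK.
  by rewrite /dW PE /B; field.
have k1pos : 0 < k1 by exact: lt_le_trans Dk1.
have ltk : k1 < k1 + 2 * pi by rewrite ltrDl mulr_gt0.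
have dWk z : k1 <= z <= k1 + 2 * pi -> is_derive z 1 (fun x => P x * B x) (dW z).
  by move=> /andP[k1z _]; apply: dWx; exact: lt_le_trans k1z.
have [c /andP[k1c ck2] Wc] := mean_value ltk dWk.
have c0 : 0 < c by exact: lt_trans k1c.
have dWc : dW c <= 0.
  rewrite /dW mulNr oppr_le0 mulr_ge0//; last first.
    rewrite mulr_ge0 ?exprn_ge0 ?sqrtr_ge0// mulr_ge0//.
      by apply/ltW/gpos; rewrite !ltW.
    by apply/ltW/sin_gt0_pi; rewrite /y; apply/andP; split; lra.
  rewrite subr_ge0 ler_pdivrMr ?mulr_gt0 ?exprn_gt0//.
  have : D%:R <= c by rewrite (le_trans Dk1)// ltW.
  by nra.
have : (P (k1 + 2 * pi) * B (k1 + 2 * pi) - P k1 * B k1) <= 0.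
  by rewrite Wc mulr_le0_ge0// subr_ge0 ltW.
have Ppos x : 0 < x -> 0 < P x by move=> x0; rewrite exprn_gt0// sqrtr_gt0.
have y1 : y k1 = 0 by rewrite /y subrr mul0r.
have y2 : y (k1 + 2 * pi) = pi by rewrite /y; field.
rewrite /B /v /v1 y1 y2 sin0 cos0 sinpi cospi !mulr0 !sub0r.
have := mulr_gt0 (Ppos _ k1pos) (gpos k1 _); rewrite lexx ltW// => /(_ isT) H1.
have := mulr_gt0 (Ppos _ (lt_trans k1pos ltk)) (gpos (k1 + 2 * pi) _).
rewrite lexx ltW// => /(_ isT) H2.
by move: H1 H2; lra.
Qed.

End bessel.

Lemma bessel_oscillates {R : realType} (g g1 g2 : R -> R) (D : nat) (K : R) :
  (2 <= D)%N ->
  (forall k : R, is_derive k 1 g (g1 k)) ->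
  (forall k : R, is_derive k 1 g1 (g2 k)) ->
  (forall k, k * (g k + g2 k) = - D%:R * g1 k) ->
  exists2 k, K < k & g k = 0.
Proof.
move=> D2 dg dg1 ode; have D0 : (0 < D)%N by exact: leq_trans D2.
apply: contrapT => noz.
pose k1 := Num.max (K + 1) D%:R.
have Kk x : k1 <= x -> K < x.
  by rewrite /k1 ge_max => /andP[Kx _]; apply: lt_le_trans Kx; rewrite ltrDl.
have Dk1 : D%:R <= k1 by rewrite /k1 le_max lexx orbT.
have gn0 x : k1 <= x -> g x != 0.
  by move=> kx; apply/eqP => gx; apply: noz; exists x => //; exact: Kk.
have same x : k1 <= x -> 0 < g k1 * g x.
  rewrite le_eqVlt => /predU1P[<-|k1x]; first by rewrite -expr2 exprn_even_gt0//= gn0.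
  rewrite ltNge; apply/negP => gg.
  have cgx : {within `[k1, x], continuous g}.
    by apply: continuous_subspaceT => z; exact: der_continuous (dg z).
  have [|c] := @IVT R g k1 x 0 (ltW k1x) cgx.
    rewrite ge_min le_max; have := gn0 _ (lexx _); have := gn0 _ (ltW k1x).
    rewrite !neq_lt => /orP[] a /orP[] b; first [by rewrite !ltW ?orbT | by nra].
  rewrite in_itv/= => /andP[k1c _] /eqP; exact/negP/gn0.
have := gn0 _ (lexx k1); rewrite neq_lt => /orP[gneg|gpos].
- apply: (@bessel_no_positive_arch R (fun k => - g k) (fun k => - g1 k) (fun k => - g2 k)
    D D0 _ _ _ k1) => //.
  + by move=> k /=; rewrite -opprD mulrN ode mulrN.
  + by move=> k /andP[/same + _] /=; rewrite nmulr_rgt0// oppr_gt0.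
- apply: (@bessel_no_positive_arch R g g1 g2 D D0 _ _ _ k1) => //.
  by move=> k /andP[/same + _] /=; rewrite pmulr_rgt0.
Qed.

Section zeros_countable.
Context {R : realType}.

(** Each point of Z is the only point of Z in some interval with rational endpoints. *)
Lemma isolated_countable (Z : set R) :
  (forall z, Z z -> exists2 e, 0 < e & forall x, Z x -> `|x - z| < e -> x = z) ->
  countable Z.
Proof.
move=> Ziso.
pose F (pq : rat * rat) := [set z : R | [/\ Z z, ratr pq.1 < z < ratr pq.2 &
  forall x : R, ratr pq.1 < x < ratr pq.2 -> Z x -> x = z]].
have : countable (\bigcup_(pq in [set: rat * rat]) F pq).
  apply: bigcup_countable => // pq _.
  have [[z Fz]|nF] := pselect (exists z, F pq z).
    apply: (sub_countable (B := [set z])); last exact: countable1.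
    by apply: subset_card_le => x [Zx px _]; case: Fz => _ _ Fz; exact: Fz.
  rewrite (_ : F pq = set0) ?countable0//.
  by rewrite -subset0 => z Fz; apply: nF; exists z.
apply: sub_countable; apply: subset_card_le => z Zz.
have [e e0 He] := Ziso _ Zz.
have [|p /[!in_itv]/= /andP[ep pz]] := @rat_in_itvoo R (z - e) z; first by lra.
have [|q /[!in_itv]/= /andP[zq qe]] := @rat_in_itvoo R z (z + e); first by lra.
exists (p, q) => //; split=> //=; first by rewrite pz zq.
move=> x /andP[px xq] Zx; apply: He => //.
by rewrite ltr_norml; apply/andP; split; lra.
Qed.

Lemma simple_zeros_countable (g g1 : R -> R) (Z : set R) :
  (forall k : R, is_derive k 1 g (g1 k)) -> continuous g1 ->
  (forall z, Z z -> g z = 0 /\ g1 z != 0) -> countable Z.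
Proof.
move=> dg cg1 Zg; apply: isolated_countable => z /Zg[gz g1z].
have [e /= e0 He] : nbhs_ball z (fun x => g1 x != 0).
  by apply/nbhs_ballP; exact: (@cvgr_neq0 R R R (nbhs z) _ g1 (g1 z) (cg1 z) g1z).
exists e => // x /Zg[gx _]; rewrite ltr_norml => /andP[ex xe].
have [xz|zx|//] := ltgtP x z; exfalso.
- have [c /andP[xc cz]] := mean_value xz (fun t _ => dg t).
  rewrite gx gz subrr => /esym/eqP; rewrite mulf_eq0 subr_eq0 (gt_eqF xz) orbF.
  by apply/negP/He; rewrite /ball/= ltr_norml; apply/andP; split; lra.
- have [c /andP[zc cx]] := mean_value zx (fun t _ => dg t).
  rewrite gx gz subrr => /esym/eqP; rewrite mulf_eq0 subr_eq0 (gt_eqF zx) orbF.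
  by apply/negP/He; rewrite /ball/= ltr_norml; apply/andP; split; lra.
Qed.

End zeros_countable.

(** * Cosine transform of the slice weight *)
Section cosine_transform.
Context {R : realType}.
Local Notation mu := (@lebesgue_measure R).
Local Notation I := (`[-1, 1]%classic : set (measurableTypeR R)).

Lemma integrable_I (f : R -> R) : continuous f -> mu.-integrable I (EFin \o f).
Proof.
move=> cf; apply: continuous_compact_integrable; first exact: segment_compact.
exact: continuous_subspaceT.
Qed.

(** With h = cos, sin and their opposites, this family is stable under
    differentiation in k. *)
Definition trig_transform (w h : R -> R) (k : R) : R := \int[mu]_(t in I) (w t * h (k * t)).

Lemma continuous_dilate (h : R -> R) (c : R) : continuous h ->
  continuous (fun t => h (c * t)).
Proof.
move=> ch t; apply: (@continuous_comp R R R (fun t : R => c * t) h); last exact: ch.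
by apply: continuousM; [exact: cst_continuous|exact: cvg_id].
Qed.

Lemma continuous_chord (c : R) m : continuous (fun t : R => Num.sqrt (c - t ^+ 2) ^+ m).
Proof.
move=> t; apply: (@continuous_comp R R R (fun t : R => Num.sqrt (c - t ^+ 2))
  (fun y : R => y ^+ m)); last exact: exprn_continuous.
apply: continuous_comp; last exact: sqrt_continuous.
by apply: continuousB; [exact: cst_continuous|exact: exprn_continuous].
Qed.

(** Differentiation under the integral sign; the domination by |w| uses |t| <= 1. *)
Lemma is_derive_trig_transform (w h h1 : R -> R) (k : R) : continuous w ->
  (forall x : R, is_derive x 1 h (h1 x)) -> (forall x, `|h1 x| <= 1) ->
  is_derive k 1 (trig_transform w h) (trig_transform (fun t => t * w t) h1 k).
Proof.
move=> cw dh h1le.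
have ch : continuous h by move=> x; exact: der_continuous (dh x).
pose f (k t : R) := w t * h (k * t).
have df k' t : is_derive (k' : R) 1 (f ^~ t) (t * w t * h1 (k' * t)).
  have := derM (der_cst (w t) k') (der_comp (derM (der_id k') (der_cst t k')) (dh _)).
  by move/der_eq; apply; ring.
have d1f k' t : partial1of2 f k' t = t * w t * h1 (k' * t).
  by rewrite partial1of2E; apply: derive_val; exact: df.
have kI : `]k - 1, k + 1[%classic k by rewrite /= in_itv/=; apply/andP; split; lra.
have intf x : `]k - 1, k + 1[%classic x -> mu.-integrable I (EFin \o f x).
  move=> _; apply: integrable_I => t; apply: continuousM; first exact: cw.
  apply: continuous_comp; last exact: ch.
  by apply: continuousM; [exact: cst_continuous|exact: cvg_id].
have derf x y : `]k - 1, k + 1[%classic x -> I y -> derivable (f ^~ y) x 1.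
  by move=> _ _; have [] := df x y.
have intG : mu.-integrable I (EFin \o (fun t => `|w t|)).
  by apply: integrable_I => t; apply: continuous_comp; [exact: cw|exact: norm_continuous].
have ubG x y : `]k - 1, k + 1[%classic x -> I y -> `|partial1of2 f x y| <= `|w y|.
  move=> _ /=; rewrite in_itv/= => y1; rewrite d1f !normrM.
  rewrite -[leRHS]mul1r -[leRHS]mulr1 ler_pM ?mulr_ge0// ler_wpM2r//.
  by rewrite ler_norml.
have mI : measurable I by exact: measurable_itv.
have derF := derivable_under_integral mI kI intf derf (fun y => normr_ge0 (w y)) intG ubG.
have F1 := differentiation_under_integral mI kI intf derf (fun y => normr_ge0 (w y)) intG ubG.
apply: (@DeriveDef _ _ _ k 1 (trig_transform w h) _ derF).
rewrite -derive1E; apply: etrans F1 _.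
by apply: eq_Rintegral => t _; rewrite d1f.
Qed.

(** Up to a constant factor, the m-dimensional volume of the section of the unit ball of
    R^(m+1) at height t. The square root is 0 outside [-1,1], so that the weight is
    continuous on R. *)
Definition slice_weight (m : nat) (t : R) : R := Num.sqrt (1 - t ^+ 2) ^+ m.

Lemma continuous_slice_weight m : continuous (slice_weight m).
Proof. exact: continuous_chord. Qed.

Section bessel_ode.
Variables (m : nat) (k : R).
Let w := slice_weight m.
Let D : R := m.+2%:R.

Let cM (f g : R -> R) : continuous f -> continuous g -> continuous (fun t => f t * g t).
Proof. by move=> cf cg t; apply: continuousM; [exact: cf|exact: cg]. Qed.

Let cD (f g : R -> R) : continuous f -> continuous g -> continuous (fun t => f t + g t).
Proof. by move=> cf cg t; apply: continuousD; [exact: cf|exact: cg]. Qed.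

Let cZ (c : R) (f : R -> R) : continuous f -> continuous (fun t => c * f t).
Proof. by apply: cM => t; exact: cst_continuous. Qed.

Let ccomp (h : R -> R) : continuous h -> continuous (fun t => h (k * t)).
Proof. exact: continuous_dilate. Qed.

Let cid : continuous (fun t : R => t). Proof. by move=> t; exact: cvg_id. Qed.

Let cN (h : R -> R) : continuous h -> continuous (fun t => - h t).
Proof. by move=> ch t; apply: continuousN; exact: ch. Qed.

(** The function (1 - t^2)^(m/2 + 1) sin(k t) vanishes at -1 and 1, so the integral of
    its derivative is 0, and this is the equation. *)
Lemma slice_weight_ode :
  k * (trig_transform w cos k + trig_transform (fun t => t * (t * w t)) (fun x => - cos x) k) =
  - D * trig_transform (fun t => t * w t) (fun x => - sin x) k.
Proof.
have cw : continuous w by exact: continuous_slice_weight.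
pose f1 t := w t * cos (k * t).
pose f2 t := t * (t * w t) * - cos (k * t).
pose f3 t := t * w t * - sin (k * t).
have cf1 : continuous f1 by apply: cM => //; apply: ccomp; exact: continuous_cos.
have if1 : mu.-integrable I (EFin \o f1).
  exact: integrable_I.
have cf2 : continuous f2.
  apply: cM; first by apply: cM => //; exact: cM.
  by apply: cN; apply: ccomp; exact: continuous_cos.
have cf3 : continuous f3.
  by apply: cM; [exact: cM|apply: cN; apply: ccomp; exact: continuous_sin].
have if2 : mu.-integrable I (EFin \o f2) by exact: integrable_I.
have if3 : mu.-integrable I (EFin \o f3) by exact: integrable_I.
have mI : measurable I by exact: measurable_itv.
pose F (t : R) : R := Num.sqrt (1 - t ^+ 2) ^+ m.+2 * sin (k * t).
have cF : continuous F.
  by apply: cM; [exact: continuous_slice_weight|apply: ccomp; exact: continuous_sin].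
have dF (t : R) : t \in `]-1, 1[ -> is_derive t 1 F (k * (f1 t + f2 t) + D * f3 t).
  rewrite in_itv/= => /andP[t1 t2]; have t0 : 0 < 1 - t ^+ 2 by nra.
  have dq : is_derive t 1 (fun t : R => 1 - t ^+ 2) (- (2 * t)).
    by apply: der_eq (derB (der_cst 1 t) (derX 2 (der_id t))) _; rewrite /=; ring.
  have dkt : is_derive t 1 (fun t : R => k * t) (0 * t + k * 1).
    exact: derM (der_cst k t) (der_id t).
  have dsin : is_derive t 1 (fun t : R => sin (k * t)) (cos (k * t) * (0 * t + k * 1)).
    exact: der_comp dkt (is_derive_sin _).
  apply: der_eq (derM (@der_sqrtX R (fun t => 1 - t ^+ 2) m t _ t0 dq) dsin) _.
  have -> : Num.sqrt (1 - t ^+ 2) ^+ m.+2 = Num.sqrt (1 - t ^+ 2) ^+ m * (1 - t ^+ 2).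
    transitivity (Num.sqrt (1 - t ^+ 2) ^+ m * Num.sqrt (1 - t ^+ 2) ^+ 2).
      by rewrite -exprD addn2.
    by congr (_ * _); exact: sqr_sqrtr (ltW t0).
  rewrite /f1 /f2 /f3 /w /slice_weight.
  by rewrite /D; field.
(* G is the derivative of F, arranged as the two sides of the equation. *)
pose G t : R := k * (f1 t + f2 t) + D * f3 t.
have cG : continuous G by exact: (cD (cZ (cD cf1 cf2)) (cZ cf3)).
have F0 : (\int[mu]_(t in I) (G t)%:E = (F 1)%:E - (F (-1))%:E)%E.
  apply: continuous_FTC2.
  - by lra.
  - exact: continuous_subspaceT.
  - split; first by move=> t /dF[].
      by apply: cvg_at_right_filter; exact: cF.
    by apply: cvg_at_left_filter; exact: cF.
  - by move=> t /dF dFt; rewrite derive1E; exact: derive_val.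
have {}F0 : \int[mu]_(t in I) G t = 0.
  by rewrite /Rintegral F0 -EFinB/= /F sqrrN !expr1n subrr sqrtr0 !expr0n/= !mul0r subrr.
have if12 : mu.-integrable I (EFin \o (fun t => f1 t + f2 t)).
  by apply: (integrableD mI if1 if2).
have ZL c f : mu.-integrable I (EFin \o f) -> mu.-integrable I (EFin \o (fun t => c * f t)).
  by move=> fi; exact: (integrableZl mI c fi).
have := F0; rewrite RintegralD//; [|exact: ZL|exact: ZL].
rewrite !RintegralZl// RintegralD//.
by rewrite /trig_transform mulNr => /eqP; rewrite addr_eq0 => /eqP.
Qed.

End bessel_ode.

End cosine_transform.

(** * Iterated integrals and the volume of balls *)
Section iterated.
Context {R : realType}.

Lemma tuple_integral {dT} {T : measurableType dT} (mu : {sigma_finite_measure set T -> \bar R})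
    n (f : n.+1.-tuple T -> \bar R) :
  (tuple_measure mu n.+1).-integrable setT f ->
  (\int[tuple_measure mu n.+1]_x f x =
   \int[mu]_t \int[tuple_measure mu n]_x f (tuple_cons (t, x)))%E.
Proof.
move=> intf; have mf : measurable_fun setT f by case/integrableP : intf.
have mc := @measurable_tuple_cons dT T n.
have intfc : (mu \x tuple_measure mu n)%E.-integrable setT (f \o tuple_cons).
  apply/integrableP; split; first exact: measurableT_comp.
  have /integrableP[_] := intf; apply: le_lt_trans.
  have -> : (\int[tuple_measure mu n.+1]_x `|f x| =
    \int[pushforward (mu \x tuple_measure mu n) (@tuple_cons _ T n)]_x `|f x|)%E by [].
  by rewrite ge0_integral_pushforward//; exact: measurableT_comp.
have -> : (\int[tuple_measure mu n.+1]_x f x =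
    \int[pushforward (mu \x tuple_measure mu n) (@tuple_cons _ T n)]_x f x)%E by [].
rewrite integral_pushforward//.
by rewrite preimage_setT -integral12_prod_meas1.
Qed.

Lemma dotp_tuple_cons n (t y : measurableTypeR R) (x e : Rn R n) :
  dotp (tuple_cons (t, x)) (tuple_cons (y, e)) = y * t + dotp x e.
Proof.
rewrite /dotp big_ord_recl !tnth0 mulrC; congr (_ + _).
by apply: eq_bigr => i _; rewrite !tnthS.
Qed.

Lemma dotp_cons n (t : measurableTypeR R) (x : Rn R n) :
  dotp (tuple_cons (t, x)) (tuple_cons (t, x)) = t ^+ 2 + dotp x x.
Proof. by rewrite dotp_tuple_cons expr2. Qed.

Local Notation I := (`[-1, 1]%classic : set (measurableTypeR R)).

(** On [0,1/2] the weight is at least 2^(-m). *)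
Lemma slice_weight_integral_gt0 m : 0 < \int[lebesgue_measure]_(t in I) slice_weight m t :> R.
Proof.
have w0 t : 0 <= slice_weight m t :> R by rewrite exprn_ge0// sqrtr_ge0.
have iw : (@lebesgue_measure R).-integrable I (EFin \o slice_weight m).
  by apply: integrable_I; exact: continuous_slice_weight.
pose J := (`[0, 1/2]%classic : set (measurableTypeR R)).
have JI : J `<=` I.
  by move=> t; rewrite /J /= !in_itv/= => /andP[t0 t1]; apply/andP; split; lra.
have mI : measurable I by exact: measurable_itv.
have mJ : measurable J by exact: measurable_itv.
have iwJ := integrableS mI mJ JI iw.
rewrite -lte_fin /Rintegral fineK; last exact: integrable_fin_num.
have mw : measurable_fun I (EFin \o slice_weight m) by case/integrableP : iw.
have w0E t : I t -> (0 <= (EFin \o slice_weight m) t)%E by move=> _; rewrite lee_fin.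
apply: lt_le_trans (ge0_subset_integral lebesgue_measure mJ mI mw w0E JI).
apply: (@lt_le_trans _ _ (\int[lebesgue_measure]_(t in J) (cst (2^-1 ^+ m)%:E) t)%E); last first.
  apply: ge0_le_integral => //.
  - by move=> t _; rewrite lee_fin exprn_ge0.
  - by apply: measurable_funS mw.
  - move=> t; rewrite /J/= in_itv/= => /andP[t0 t1]; rewrite lee_fin /slice_weight.
    apply: lerXn2r; rewrite ?nnegrE ?sqrtr_ge0//.
    rewrite -(@ger0_norm _ (2^-1 : R))// -sqrtr_sqr ler_sqrt; nra.
have lJ : lebesgue_measure J = (2^-1)%:E.
  rewrite /J lebesgue_measure_itv/= lte_fin divr_gt0// -EFinB.
  by congr (_%:E); rewrite subr0 mul1r.
rewrite integral_cst// [X in (_ * X)%E](_ : _ = (2^-1)%:E); last exact: lJ.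
by rewrite -EFinM lte_fin mulr_gt0 ?exprn_gt0// invr_gt0.
Qed.

Lemma slice_weight_scale m (s : R) : 0 <= s ->
  \int[lebesgue_measure]_(t in (`[- s, s]%classic : set (measurableTypeR R)))
     Num.sqrt (s ^+ 2 - t ^+ 2) ^+ m =
  s ^+ m.+1 * \int[lebesgue_measure]_(t in I) slice_weight m t.
Proof.
rewrite le_eqVlt => /predU1P[<-|s0].
  by rewrite oppr0 set_itv1 Rintegral_set1 expr0n mul0r.
have dsM : derive1 ( *%R s : R -> R) = cst s.
  apply/funext => z; rewrite derive1E; apply: derive_val.
  by apply: der_eq (derM (der_cst s z) (der_id z)) _; rewrite /=; ring.
pose G (t : R) : R := Num.sqrt (s ^+ 2 - t ^+ 2) ^+ m.
have cG : continuous G by exact: continuous_chord.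
have csM : continuous ( *%R s : R -> R).
  by move=> t; apply: continuousM; [exact: cst_continuous|exact: cvg_id].
have lt11 : (-1 : R) <= 1 by lra.
have := @integration_by_substitution_increasing R ( *%R s) G _ _ lt11.
rewrite mulrN1 mulr1 dsM => H.
rewrite /Rintegral H; first last.
- exact: continuous_subspaceT.
- split => //.
  + by apply: cvg_at_right_filter; exact: csM.
  + by apply: cvg_at_left_filter; exact: csM.
- exact: is_cvg_cst.
- exact: is_cvg_cst.
- by move=> z _; exact: cvg_cst.
- by move=> a b _ _ ab; rewrite ltr_pM2l.
have mI : measurable I by exact: measurable_itv.
have iw : (@lebesgue_measure R).-integrable I (EFin \o slice_weight m).
  by apply: integrable_I; exact: continuous_slice_weight.
rewrite -(RintegralZl _ mI iw).
congr fine; apply: eq_integral => t _ /=; congr (_%:E).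
transitivity (s * Num.sqrt (s ^+ 2 - (s * t) ^+ 2) ^+ m); first by rewrite mulrC.
rewrite [in RHS]exprS -mulrA; congr (s * _).
rewrite /slice_weight -exprMn; congr (_ ^+ _).
rewrite -[X in _ = X * _](@ger0_norm _ s) ?ltW// -sqrtr_sqr -sqrtrM ?sqr_ge0//.
by congr Num.sqrt; ring.
Qed.

(** By induction on the dimension: the section at height t is a ball of radius
    (s^2 - t^2)^(1/2). Homogeneity in s is what turns the volumes of the sections into
    a multiple of the slice weight. *)
Lemma ball_volume n : exists2 c : R, 0 < c & forall s : R, 0 <= s ->
  lebesgue_Rn [set x : Rn R n | dotp x x <= s ^+ 2] = (c * s ^+ n)%:E.
Proof.
elim: n => [|n [c c0 IH]].
  exists 1 => // s s0; rewrite [LHS]diracE mem_set ?mulr1//=.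
  by rewrite /dotp big_ord0 sqr_ge0.
exists (c * \int[lebesgue_measure]_(t in I) slice_weight n t).
  by rewrite mulr_gt0// slice_weight_integral_gt0.
move=> s s0; rewrite /lebesgue_Rn tuple_measureSE.
rewrite -mulrA [_ * s ^+ _]mulrC -slice_weight_scale//.
pose J := (`[- s, s]%classic : set (measurableTypeR R)).
transitivity (\int[lebesgue_measure]_(t in J) (c * Num.sqrt (s ^+ 2 - t ^+ 2) ^+ n)%:E)%E.
  rewrite [RHS]integral_mkcond; apply: eq_integral => t _; rewrite patchE.
  have [|tJ] := boolP (t \in J).
    rewrite inE /J/= in_itv/= => /andP[st ts]; rewrite -IH ?sqrtr_ge0//.
    congr (_ _); apply/seteqP; split => x /=;
      rewrite dotp_cons sqr_sqrtr ?lerBrDl//; nra.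
  rewrite (_ : [set _ | _] = set0) ?measure0//.
  rewrite -subset0 => x /=; rewrite dotp_cons => tx.
  move/negP: tJ; apply; rewrite inE /J/= in_itv/=.
  have := dotp_ge0 x => x0; apply/andP; split; nra.
have iw : (@lebesgue_measure R).-integrable J
    (EFin \o (fun t : R => Num.sqrt (s ^+ 2 - t ^+ 2) ^+ n)).
  apply: continuous_compact_integrable; first exact: segment_compact.
  by apply: continuous_subspaceT; exact: continuous_chord.
have mJ : measurable J by exact: measurable_itv.
under eq_integral do rewrite EFinM.
rewrite integralZl// EFinM; congr (_ * _)%E.
by rewrite /Rintegral fineK//; exact: integrable_fin_num.
Qed.

End iterated.

(** * Fourier transform of the ball *)
Section ball_profile.
Context {R : realType}.
Local Notation I := (`[-1, 1]%classic : set (measurableTypeR R)).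

Lemma unit_ball_finite n : (lebesgue_Rn (unit_ball R n) < +oo)%E.
Proof.
have [c _ /(_ 1 ler01) H] := @ball_volume R n.
by move: H; rewrite expr1n unit_ballE => ->; rewrite ltry.
Qed.

Lemma measurable_unit_ball n : measurable (unit_ball R n).
Proof. by rewrite unit_ballE; exact: measurable_ball. Qed.

Lemma integrable_bounded {dT} {T : measurableType dT} (mu : {measure set T -> \bar R})
    (B : set T) (f : T -> R) :
  measurable B -> (mu B < +oo)%E -> measurable_fun setT f -> (forall x, `|f x| <= 1) ->
  mu.-integrable B (EFin \o f).
Proof.
move=> mB Bfin mf f1; apply: measurable_bounded_integrable => //.
  exact: measurable_funS mf.
exists 1; split; first exact: num_real.
by move=> M M1 x _ /=; rewrite (le_trans (f1 x))// ltW.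
Qed.

Lemma ball_slice n : exists2 c : R, 0 < c & forall h : R -> R, continuous h ->
  (forall t, `|h t| <= 1) ->
  \int[lebesgue_Rn]_(x in unit_ball R n.+1) h (tnth x ord0) =
  c * \int[lebesgue_measure]_(t in I) (slice_weight n t * h t).
Proof.
have [c c0 cE] := @ball_volume R n; exists c => // h ch h1.
have mh : measurable_fun setT h by exact: continuous_measurable_fun.
have mhx : measurable_fun setT (fun x : Rn R n.+1 => h (tnth x ord0)).
  by apply: measurableT_comp => //; exact: measurable_tnth.
have mB := @measurable_unit_ball n.+1.
have ih : (@lebesgue_Rn R n.+1).-integrable (unit_ball R n.+1)
    (EFin \o (fun x : Rn R n.+1 => h (tnth x ord0))).
  by apply: integrable_bounded => //; exact: unit_ball_finite.
have iw : (@lebesgue_measure R).-integrable I (EFin \o (fun t => slice_weight n t * h t)).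
  by apply: integrable_I => t; apply: continuousM; [exact: continuous_slice_weight|exact: ch].
have mI : measurable I by exact: measurable_itv.
rewrite -RintegralZl//; congr fine.
(* Indicators turn integrals over the ball and over its sections into integrals over
   the whole space, to which the product structure applies. *)
rewrite integral_mkcond /lebesgue_Rn tuple_integral; last exact/(integrable_mkcond _ mB).
rewrite [RHS]integral_mkcond; apply: eq_integral => t _; rewrite patchE.
pose S : set (Rn R n) := [set x | (t : R) ^+ 2 + dotp x x <= 1].
transitivity (\int[lebesgue_Rn]_(x in S) cst (h t)%:E x)%E.
  rewrite [RHS]integral_mkcond; apply: eq_integral => x _; rewrite !patchE unit_ballE.
  have -> : (tuple_cons (t, x) \in [set x : Rn R n.+1 | dotp x x <= 1]) =
     (x \in S).
    by apply/idP/idP; rewrite !inE/= dotp_cons.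
  by rewrite tnth0.
have SE : S = [set x : Rn R n | dotp x x <= 1 - t ^+ 2].
  by apply/seteqP; split => x /=; rewrite lerBrDl.
rewrite integral_cst; last by rewrite SE; exact: measurable_ball.
have [|tI] := boolP (t \in I).
  rewrite inE/= in_itv/= => /andP[t1 t2].
  rewrite SE -[X in (_ * X)%E](_ : (c * Num.sqrt (1 - t ^+ 2) ^+ n)%:E = _).
    by rewrite -EFinM /slice_weight; congr (_%:E); ring.
  by rewrite -cE ?sqrtr_ge0// sqr_sqrtr//; nra.
rewrite SE [X in (_ * X)%E](_ : _ = 0%E) ?mule0//.
rewrite -SE (_ : S = set0) ?measure0//.
rewrite -subset0 => x tx; rewrite /S/= in tx; move/negP: tI; apply; rewrite inE/= in_itv/=.
have := dotp_ge0 x => x0; apply/andP; split; nra.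
Qed.

(** After rotation of eta onto the first axis, the real part is computed by slices. The
    imaginary part is the integral of an odd function of x.eta. *)
Lemma ball_fourier n : exists2 c : R, 0 < c & forall eta : Rn R n.+2,
  Cintegral (unit_ball R n.+2) (fun x => expi (2 * pi * dotp x eta)) =
  ((c * trig_transform (slice_weight n.+1) cos (2 * pi * enorm eta)) +i* 0)%C.
Proof.
have [c c0 cE] := ball_slice n.+1; exists c => // eta.
have [r rE rP] := same_profile_axis eta.
have slice (h : R -> R) : continuous h -> (forall t, `|h t| <= 1) ->
    forall r, \int[lebesgue_Rn]_(x in unit_ball R n.+2) h (2 * pi * dotp x (axis n.+1 r)) =
     c * \int[lebesgue_measure]_(t in I) (slice_weight n.+1 t * h (2 * pi * (r * t))).
  move=> ch h1 s.
  have chs : continuous (fun t => h (2 * pi * (s * t))).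
    exact: (@continuous_dilate R (fun u => h (2 * pi * u)) s (continuous_dilate (c := 2 * pi) ch)).
  rewrite -(cE (fun t => h (2 * pi * (s * t))))//.
  by apply: eq_Rintegral => x _; rewrite dotp_axis.
have mphi (h : R -> R) : continuous h -> measurable_fun setT (fun y : R => h (2 * pi * y)).
  by move=> ch; apply: continuous_measurable_fun; exact: continuous_dilate.
congr (_ +i* _)%C => /=.
  rewrite (rP (fun y => cos (2 * pi * y)))//; last by apply: mphi; exact: continuous_cos.
  rewrite slice; [|exact: continuous_cos|exact: cos_norm].
  congr (_ * _); apply: eq_Rintegral => t _; congr (_ * _).
  have : enorm eta = `|r| by rewrite /enorm -rE sqrtr_sqr.
  have [r0|r0] := ger0P r => ->; first by rewrite mulrA.
  by rewrite mulrN mulNr cosN mulrA.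
have msin : measurable_fun setT (fun y : R => sin (2 * pi * y)).
  by apply: mphi; exact: continuous_sin.
rewrite (rP (fun y => sin (2 * pi * y)))//.
have := same_profile_axisN n r msin.
rewrite !slice; try solve [exact: continuous_sin | exact: sin_norm].
have mI : measurable I by exact: measurable_itv.
have iS : (@lebesgue_measure R).-integrable I
    (EFin \o (fun t => slice_weight n.+1 t * sin (2 * pi * (r * t)))).
  apply: integrable_I => t; apply: continuousM; first exact: continuous_slice_weight.
  exact: (@continuous_dilate R (fun u => sin (2 * pi * u)) r
    (continuous_dilate (c := 2 * pi) (@continuous_sin R))).
set S := \int[lebesgue_measure]_(t in I) (slice_weight n.+1 t * sin (2 * pi * (r * t))).
have -> : \int[lebesgue_measure]_(t in I) (slice_weight n.+1 t * sin (2 * pi * (- r * t))) = - S.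
  rewrite -[RHS]mulN1r /S -(RintegralZl _ mI iS).
  by apply: eq_Rintegral => t _; rewrite mulNr mulrN sinN; ring.
by rewrite mulrN => /eqP; rewrite -addr_eq0 -mulr2n mulrn_eq0/= => /eqP.
Qed.

End ball_profile.

(** * Radii of the zeros for the ball *)
Section zero_radii.
Context {R : realType}.

(** The radii are the zeros of the cosine transform of the slice weight, rescaled by
    2 pi; the equation of slice_weight_ode gives their countability and their
    unboundedness. The value at 0 is the integral of the weight, which is why 0 is not
    a radius. *)
Lemma ball_zeros n : exists Z : set R, [/\ countable Z,
  (forall K, exists2 r, Z r & K < r), (forall r, Z r -> 0 < r) &
  forall eta : Rn R n.+2,
  Cintegral (unit_ball R n.+2) (fun x => expi (2 * pi * dotp x eta)) = 0 <->
  Z (enorm eta)].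
Proof.
have [c c0 cE] := @ball_fourier R n.
pose w : R -> R := slice_weight n.+1; pose g := trig_transform w cos.
pose w1 t := t * w t; pose w2 t := t * w1 t.
pose g1 := trig_transform w1 (fun x => - sin x); pose g2 := trig_transform w2 (fun x => - cos x).
have cw : continuous w by exact: continuous_slice_weight.
have cw1 : continuous w1.
  by move=> t; apply: continuousM; [exact: cvg_id|exact: cw].
have dg (k : R) : is_derive k 1 g (g1 k).
  apply: (@is_derive_trig_transform R w cos (fun x => - sin x) k cw (@is_derive_cos R)).
  by move=> x; rewrite normrN sin_norm.
have dg1 (k : R) : is_derive k 1 g1 (g2 k).
  apply: (@is_derive_trig_transform R w1 (fun x => - sin x) (fun x => - cos x) k cw1).
  by move=> x; rewrite normrN cos_norm.
have ode k : k * (g k + g2 k) = - n.+3%:R * g1 k by exact: slice_weight_ode.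
have g0 : g 0 != 0.
  rewrite gt_eqF// /g /trig_transform; under eq_Rintegral do rewrite mul0r cos0 mulr1.
  exact: slice_weight_integral_gt0.
have pi2 : 0 < 2 * pi :> R by rewrite mulr_gt0// pi_gt0.
exists [set r | 0 < r /\ g (2 * pi * r) = 0]; split.
- have : countable [set k | 0 < k /\ g k = 0].
    apply: (simple_zeros_countable dg (g1 := g1)).
      by move=> k; exact: der_continuous (dg1 k).
    move=> z [z0 gz]; split => //.
    by apply: (bessel_simple_zero _ dg dg1 ode).
  move=> /countable_injP[f finj]; apply/countable_injP.
  exists (fun r => f (2 * pi * r)) => x y; rewrite !inE => -[x0 gx] [y0 gy] fxy.
  apply: (mulfI (lt0r_neq0 pi2)); apply: finj => //; rewrite inE; split => //; exact: mulr_gt0.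
- move=> K.
  have [k Kk gk] := bessel_oscillates (Num.max 0 (2 * pi * K)) (isT : (2 <= n.+3)%N) dg dg1 ode.
  move: Kk; rewrite gt_max => /andP[k0 Kk]; exists (k / (2 * pi)).
    by split; [rewrite divr_gt0|rewrite mulrC divfK// gt_eqF].
  by rewrite ltr_pdivlMr// mulrC.
- by move=> r [].
- move=> eta; rewrite cE; split.
    move=> [/eqP]; rewrite mulf_eq0 (gt_eqF c0)/= => /eqP gz; split => //.
    rewrite lt_neqAle sqrtr_ge0 andbT eq_sym; apply/eqP => e0.
    by move: gz; rewrite e0 mulr0; exact/eqP.
  by move=> [_ gz]; rewrite -/w -/g gz mulr0.
Qed.

End zero_radii.

(** * Fourier transform of the cube *)
Section cube.
Context {R : realType}.
Local Notation J := (`[0, 1]%classic : set (measurableTypeR R)).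

Lemma measurable_cube n : measurable (unit_cube R n).
Proof.
rewrite (_ : unit_cube R n = \bigcap_(j in [set: 'I_n])
    (setT `&` (fun x : Rn R n => tnth x j) @^-1` J)).
  apply: fin_bigcap_measurable => // j _.
  by apply: measurable_tnth => //; exact: measurable_itv.
apply/seteqP; split => x /=.
  by move=> xj j _; split=> //=; rewrite in_itv/=.
by move=> xj j; have [_ /=] := xj j I; rewrite in_itv.
Qed.

Lemma cube_cons n (t : measurableTypeR R) (x : Rn R n) :
  unit_cube R n.+1 (tuple_cons (t, x)) <-> J t /\ unit_cube R n x.
Proof.
rewrite /unit_cube /= in_itv/=; split.
  move=> H; split; first by have := H ord0; rewrite tnth0.
  by move=> j; have := H (lift ord0 j); rewrite tnthS.
move=> [t01 H] j; case: (unliftP ord0 j) => [i ->|->]; first by rewrite tnthS.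
by rewrite tnth0.
Qed.

Lemma lebesgue_segment01 : lebesgue_measure J = 1%E.
Proof. by rewrite lebesgue_measure_itv/= lte01 sube0. Qed.

Lemma cube_volume n : lebesgue_Rn (unit_cube R n) = 1%E.
Proof.
elim: n => [|n IH]; first by rewrite [LHS]diracE mem_set//= => -[].
rewrite /lebesgue_Rn tuple_measureSE.
transitivity (\int[lebesgue_measure]_(t in J) cst 1%E t)%E.
  rewrite [RHS]integral_mkcond; apply: eq_integral => t _; rewrite patchE.
  have [tJ|tJ] := boolP (t \in J).
    rewrite inE in tJ; rewrite -IH; congr (_ _).
    by apply/seteqP; split => x /=; rewrite cube_cons; tauto.
  rewrite (_ : [set _ | _] = set0) ?measure0//.
  rewrite -subset0 => x /=; rewrite cube_cons => -[tJ' _].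
  by move/negP: tJ; apply; rewrite inE.
rewrite integral_cst; last exact: measurable_itv.
by rewrite mul1e; exact: lebesgue_segment01.
Qed.

Lemma integrable_cube n (f : Rn R n -> R) : measurable_fun setT f ->
  (forall x, `|f x| <= 1) -> (@lebesgue_Rn R n).-integrable (unit_cube R n) (EFin \o f).
Proof.
move=> mf f1; apply: integrable_bounded => //; first exact: measurable_cube.
by apply: (@le_lt_trans _ _ 1%E); [rewrite -(cube_volume n)|exact: ltry].
Qed.

Lemma cube_slice n (f : Rn R n.+1 -> R) : measurable_fun setT f ->
  (forall x, `|f x| <= 1) ->
  \int[lebesgue_Rn]_(x in unit_cube R n.+1) f x =
  \int[lebesgue_measure]_(t in J)
    \int[lebesgue_Rn]_(x in unit_cube R n) f (tuple_cons (t : measurableTypeR R, x)).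
Proof.
move=> mf f1; have mQ := @measurable_cube n.+1.
have intf := integrable_cube mf f1.
congr fine.
rewrite integral_mkcond /lebesgue_Rn tuple_integral; last exact/(integrable_mkcond _ mQ).
rewrite [RHS]integral_mkcond; apply: eq_integral => t _; rewrite patchE.
have mft : measurable_fun setT (fun x : Rn R n => f (tuple_cons (t, x))).
  by apply: measurableT_comp => //; exact: measurable_consr.
have intft := integrable_cube mft (fun x => f1 (tuple_cons (t, x))).
have [tJ|tJ] := boolP (t \in J).
  rewrite /Rintegral fineK; last exact: (integrable_fin_num (@measurable_cube n) intft).
  rewrite [RHS]integral_mkcond; apply: eq_integral => x _; rewrite !patchE.
  rewrite inE in tJ.
  have -> // : (tuple_cons (t, x) \in unit_cube R n.+1) = (x \in unit_cube R n).
  by apply/idP/idP; rewrite !inE cube_cons; [case|split].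
apply: integral0_eq => x _; rewrite patchE ifF//.
apply/negP; rewrite inE cube_cons => -[tJ' _].
by move/negP: tJ; apply; rewrite inE.
Qed.

Definition cube_fourier n (eta : Rn R n) : R[i] :=
  Cintegral (unit_cube R n) (fun x => expi (2 * pi * dotp x eta)).

Definition segment_fourier (y : R) : R[i] :=
  ((\int[lebesgue_measure]_(t in J) cos (2 * pi * (y * t))) +i*
   (\int[lebesgue_measure]_(t in J) sin (2 * pi * (y * t))))%C.

Lemma measurable_wave n (h : R -> R) (e : Rn R n) : continuous h ->
  measurable_fun setT (fun x : Rn R n => h (2 * pi * dotp x e)).
Proof.
move=> ch; apply: (@measurableT_comp _ _ _ _ _ _ (fun y : R => h (2 * pi * y))).
  by apply: continuous_measurable_fun; exact: continuous_dilate.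
exact: measurable_dotp.
Qed.

Lemma integrable_seg (h : R -> R) (y : R) : continuous h ->
  (@lebesgue_measure R).-integrable J (EFin \o (fun t => h (2 * pi * (y * t)))).
Proof.
move=> ch; apply: continuous_compact_integrable; first exact: segment_compact.
apply: continuous_subspaceT.
exact: (@continuous_dilate R (fun u => h (2 * pi * u)) y (continuous_dilate (c := 2 * pi) ch)).
Qed.

(** The exponential of a sum is a product, written out on real and imaginary parts. *)
Lemma cube_fourier_cons n (y : measurableTypeR R) (e : Rn R n) :
  cube_fourier (tuple_cons (y, e)) = segment_fourier y * cube_fourier e.
Proof.
have mJ : measurable J by exact: measurable_itv.
have mQ := @measurable_cube n.
have mc := measurable_wave e (@continuous_cos R).
have ms := measurable_wave e (@continuous_sin R).
have ic := integrable_cube mc (fun x => cos_norm _).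
have is' := integrable_cube ms (fun x => sin_norm _).
have jc := integrable_seg y (@continuous_cos R).
have js := integrable_seg y (@continuous_sin R).
have ZL d (T : measurableType d) (mu : {measure set T -> \bar R}) (D : set T) f c :
    measurable D -> mu.-integrable D (EFin \o f) -> mu.-integrable D (EFin \o (fun t => c * f t)).
  by move=> mD fi; exact: (integrableZl mD c fi).
have ZR d (T : measurableType d) (mu : {measure set T -> \bar R}) (D : set T) f c :
    measurable D -> mu.-integrable D (EFin \o f) -> mu.-integrable D (EFin \o (fun t => f t * c)).
  by move=> mD fi; under eq_fun do rewrite mulrC; exact: ZL.
rewrite /cube_fourier /Cintegral /segment_fourier /=; simpc; congr (_ +i* _)%C.
- rewrite cube_slice; last first.
  + by move=> x; exact: cos_norm.
  + exact: measurable_wave (@continuous_cos R).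
  rewrite -!RintegralZr// -RintegralB//; [|exact: ZR|exact: ZR].
  apply: eq_Rintegral => t _.
  rewrite -!RintegralZl// -RintegralB//; [|exact: ZL|exact: ZL].
  by apply: eq_Rintegral => x _; rewrite dotp_tuple_cons mulrDr cosD.
- rewrite cube_slice; last first.
  + by move=> x; exact: sin_norm.
  + exact: measurable_wave (@continuous_sin R).
  rewrite -!RintegralZr// -RintegralD//; [|exact: ZR|exact: ZR].
  apply: eq_Rintegral => t _.
  rewrite -!RintegralZl// -RintegralD//; [|exact: ZL|exact: ZL].
  by apply: eq_Rintegral => x _; rewrite dotp_tuple_cons mulrDr sinD addrC.
Qed.

Lemma cos_period (z : int) : cos (2 * pi * z%:~R) = 1 :> R.
Proof.
have H (k : nat) : cos (2 * pi * k%:R) = 1 :> R.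
  have := @periodicn R R cos (pi *+ 2) (@cosD2pi R) k 0.
  by rewrite add0r cos0; apply: etrans; congr cos; rewrite -[in RHS]mulr_natr -(mulr_natl pi 2).
case: z => k; first by rewrite -pmulrn H.
by rewrite NegzE mulrNz mulrN cosN -pmulrn H.
Qed.

(** The fractional part u of y satisfies 1 - 2 sin(pi u)^2 = cos(2 pi u) = 1 with
    0 <= u < 1, and sin(pi u) > 0 unless u = 0. *)
Lemma cos1_int (y : R) : cos (2 * pi * y) = 1 -> exists z : int, y = z%:~R.
Proof.
move=> c1; exists (Num.floor y).
pose u := y - (Num.floor y)%:~R.
have u0 : 0 <= u by rewrite subr_ge0 ge_floor.
have u1 : u < 1 by rewrite ltrBlDl -intrD1; exact: floorD1_gt.
have sp : sin (2 * pi * (Num.floor y)%:~R) = 0 :> R.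
  apply/eqP; rewrite -norm_cos_eq1 cos_period normr1//.
have cu : cos (2 * pi * u) = 1.
  by rewrite /u mulrBr cosB c1 cos_period sp mulr0 addr0 mulr1.
apply/eqP; rewrite -subr_eq0 -/u; apply/negPn/negP => un0.
have : 0 < sin (pi * u).
  have ugt0 : 0 < u by rewrite lt_neqAle eq_sym un0.
  by apply: sin_gt0_pi; rewrite mulr_gt0 ?pi_gt0//= gtr_pMr ?pi_gt0.
have : cos (2 * pi * u) = 1 - 2 * sin (pi * u) ^+ 2.
  rewrite (_ : 2 * pi * u = (pi * u) *+ 2); last by rewrite -(mulr_natl (pi * u)) mulrA.
  by rewrite cos_mulr2n cos2sin2; ring.
rewrite cu => ce; nra.
Qed.

(** For y <> 0 the transform is (sin k + i (1 - cos k)) / k with k = 2 pi y. *)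
Lemma segment_fourier0 (y : R) : segment_fourier y = 0 <-> exists2 z : int, z != 0 & y = z%:~R.
Proof.
have pi0 := pi_gt0 R.
have [->|y0] := eqVneq y 0.
  split=> [[H _]|[z z0 /esym/eqP]]; last by rewrite intr_eq0 (negbTE z0).
  exfalso; move: H; under eq_Rintegral do rewrite mul0r mulr0 cos0.
  rewrite Rintegral_cst; last exact: measurable_itv.
  rewrite [X in fine X](_ : _ = 1%E); last exact: lebesgue_segment01.
  by rewrite mulr1; move/eqP; rewrite oner_eq0.
have k0 : 2 * pi * y != 0 by rewrite !mulf_neq0// gt_eqF.
set k := 2 * pi * y in k0 *.
have dk (t : R) : is_derive t 1 (fun t : R => k * t) k.
  by apply: der_eq (derM (der_cst k t) (der_id t)) _; rewrite /=; ring.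
have ftc (F f : R -> R) : continuous f -> (forall t : R, is_derive t 1 F (f t)) ->
    \int[lebesgue_measure]_(t in J) f t = F 1 - F 0.
  move=> cf dF; have cF : continuous F by move=> t; exact: der_continuous (dF t).
  rewrite /Rintegral (@continuous_FTC2 _ _ F) ?ltr01//; last 3 first.
  - exact: continuous_subspaceT.
  - split; first by move=> t _; have [] := dF t.
      by apply: cvg_at_right_filter; exact: cF.
    by apply: cvg_at_left_filter; exact: cF.
  - by move=> t _; rewrite derive1E; exact: derive_val.
have cE : \int[lebesgue_measure]_(t in J) cos (2 * pi * (y * t)) = sin k / k.
  under eq_Rintegral do rewrite mulrA -/k.
  have dF (t : R) : is_derive t 1 (fun t : R => sin (k * t) / k) (cos (k * t)).
    apply: der_eq (derM (der_comp (dk t) (is_derive_sin _)) (der_cst k^-1 t)) _.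
    by field.
  apply: etrans (ftc _ _ (continuous_dilate (c := k) (@continuous_cos R)) dF) _.
  by rewrite mulr0 mulr1 sin0 mul0r subr0.
have sE : \int[lebesgue_measure]_(t in J) sin (2 * pi * (y * t)) = (1 - cos k) / k.
  under eq_Rintegral do rewrite mulrA -/k.
  have dF (t : R) : is_derive t 1 (fun t : R => (1 - cos (k * t)) / k) (sin (k * t)).
    apply: der_eq (derM (derB (der_cst 1 t) (der_comp (dk t) (is_derive_cos _)))
      (der_cst k^-1 t)) _.
    by field.
  apply: etrans (ftc _ _ (continuous_dilate (c := k) (@continuous_sin R)) dF) _.
  by rewrite mulr0 mulr1 cos0 subrr mul0r subr0.
rewrite /segment_fourier cE sE; split.
  move=> [_ /eqP]; rewrite mulf_eq0 invr_eq0 (negbTE k0) orbF subr_eq0 => /eqP/esym.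
  move=> /cos1_int[z yz]; exists z => //.
  by apply: contra_neq y0 => z0; rewrite yz z0.
move=> [z _ yz]; have ck1 : cos k = 1 by rewrite /k yz cos_period.
rewrite ck1 subrr mul0r.
have /eqP -> : sin k == 0 by rewrite -norm_cos_eq1 ck1 normr1.
by rewrite mul0r.
Qed.

Lemma cube_zero n (eta : Rn R n) :
  Cintegral (unit_cube R n) (fun x => expi (2 * pi * dotp x eta)) = 0 <->
  exists j, exists2 z : int, z != 0 & tnth eta j = z%:~R :> R.
Proof.
rewrite -/(cube_fourier eta); elim: n eta => [|n IH] eta.
  split=> [[H _]|[[]]//]; exfalso; move: H.
  under eq_Rintegral do rewrite /= /dotp big_ord0 mulr0 cos0.
  rewrite Rintegral_cst; last exact: measurable_cube.
  rewrite [X in fine X](_ : _ = 1%E); last exact: cube_volume.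
  by rewrite mulr1; move/eqP; rewrite oner_eq0.
rewrite -(tuple_unconsK eta); case: (tuple_uncons eta) => y e.
rewrite cube_fourier_cons; split.
  move=> /eqP; rewrite mulf_eq0 => /orP[/eqP/segment_fourier0[z z0 yz]|/eqP/IH[j [z z0 ez]]].
    by exists ord0, z.
  by exists (lift ord0 j), z; rewrite // tnthS.
move=> [j [z z0]]; case: (unliftP ord0 j) => [i ->|->].
  rewrite tnthS => ez; apply/eqP; rewrite mulf_eq0; apply/orP; right.
  by apply/eqP/IH; exists i, z.
by rewrite tnth0 => yz; rewrite (_ : segment_fourier y = 0) ?mul0r//; apply/segment_fourier0; exists z.
Qed.

End cube.

(** * Geometric consequences *)
Section geometry.
Context {R : realType}.

Lemma incompleteP n (Om A : set (Rn R n)) : ~ complete_exp_system Om A <->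
  exists xi, forall a, A a ->
    Cintegral Om (fun x => expi (2 * pi * dotp x (Rn_sub a xi))) = 0.
Proof.
split=> [/existsNP[xi H]|[xi H] /(_ xi)[a /H ->]]; last by rewrite eqxx.
by exists xi => a Aa; apply/eqP/negPn/negP => Fa; apply: H; exists a.
Qed.

Lemma enorm_sqr n (x : Rn R n) : enorm x ^+ 2 = dotp x x.
Proof. by rewrite /enorm sqr_sqrtr// dotp_ge0. Qed.

Lemma enormP n (x : Rn R n) r : 0 <= r -> dotp x x = r ^+ 2 -> enorm x = r.
Proof. by move=> r0 xr; rewrite /enorm xr sqrtr_sqr ger0_norm. Qed.

(** The points of A are equidistant from each point xi + t u of the line. The square of
    the common distance is a quadratic polynomial in t with leading coefficient |u|^2,
    so it takes all large values, among which the square of a zero radius. *)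
Lemma equidistant_incomplete n (A : set (Rn R n.+2)) (xi u : Rn R n.+2) (q b : R) :
  0 < dotp u u ->
  (forall a, A a -> dotp (Rn_sub a xi) (Rn_sub a xi) = q /\ dotp (Rn_sub a xi) u = b) ->
  ~ complete_exp_system (unit_ball R n.+2) A.
Proof.
move=> u0 Aq; have [Z [_ Zub Zpos ZE]] := @ball_zeros R n.
have [r Zr] := Zub (Num.max 1 q); rewrite gt_max => /andP[r1 rq].
apply/incompleteP; set C := dotp u u in u0.
pose disc := b ^+ 2 + C * (r ^+ 2 - q).
have disc0 : 0 <= disc by rewrite addr_ge0 ?sqr_ge0// mulr_ge0 ?ltW// subr_gt0; nra.
(* The larger root of C t^2 - 2 b t + q = r^2; the discriminant is nonnegative
   because r > max 1 q implies r^2 > q. *)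
pose t := (b + Num.sqrt disc) / C.
have tE : C * t ^+ 2 - 2 * t * b + q = r ^+ 2.
  have Cn0 : C != 0 by rewrite gt_eqF.
  have -> : C * t ^+ 2 - 2 * t * b + q = (Num.sqrt disc ^+ 2 - b ^+ 2) / C + q.
    by rewrite /t; field.
  by rewrite sqr_sqrtr// /disc; field.
exists [tuple (tnth xi j : R) + t * tnth u j | j < n.+2] => a /Aq[aq ab].
apply/ZE; rewrite (_ : enorm _ = r)//; apply: enormP; first exact/ltW/Zpos.
rewrite -tE -aq -ab /C /dotp mulr_suml mulr_sumr -sumrB -big_split/=.
by apply: eq_bigr => j _; rewrite !tnth_mktuple; ring.
Qed.

(** Each of the n + 1 points differs from xi by a nonzero integer in some coordinate.
    There are n coordinates, so two points share one, and their difference in that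
    coordinate is an integer. *)
Lemma cube_incomplete_null n :
  null_tuples [set a : n.+1.-tuple (Rn R n) |
    ~ complete_exp_system (unit_cube R n) (points a)].
Proof.
pose D := [set i : 'I_n.+1 * 'I_n.+1 * 'I_n * int | i.1.1.1 != i.1.1.2].
pose F (i : 'I_n.+1 * 'I_n.+1 * 'I_n * int) := [set a : n.+1.-tuple (Rn R n) |
  tuple_coord (i.1.1.1, i.1.2) a - tuple_coord (i.1.1.2, i.1.2) a - i.2%:~R = 0 :> R].
apply: (@negligibleS _ _ _ _ (\bigcup_(i in D) F i)).
  move=> a /= /incompleteP[xi H].
  have {}H k : exists j, exists2 z : int, z != 0 & (tnth (tnth a k) j : R) - tnth xi j = z%:~R.
    have /cube_zero[j [z z0 e]] := H _ (imageT (tnth a) k).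
    by exists j, z => //; rewrite -e tnth_mktuple.
  have [f fP] := choice H.
  have /injectivePn[k [l kl fkl]] : ~~ injectiveb f.
    by apply/negP => /injectiveP/leq_card; rewrite !card_ord ltnn.
  have [z _ ez] := fP k; have [w _ ew] := fP l.
  exists (k, l, f k, z - w) => //=.
  rewrite /F /tuple_coord/= intrB -ez -ew -fkl; ring.
apply: negligible_countable; first exact: countableP.
move=> [[[k l] j] z]; rewrite /D/= => kl.
apply: (@null_zero_polyfun _ _ _ (fun a => tuple_coord (k, j) a - tuple_coord (l, j) a - z%:~R)
  [tuple [tuple if i == k then z%:~R + 1 else 0 : measurableTypeR R | _ < n] | i < n.+1]).
  by apply: polyfun_sub; [apply: polyfun_sub; exact: polyfun_gen|exact: polyfun_cst].
rewrite /tuple_coord/= !tnth_mktuple eqxx (eq_sym l) (negbTE kl) subr0 addrAC subrr add0r.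
exact: oner_neq0.
Qed.

(** Number the points of A by distinct coordinates, and let the coordinate j of xi be
    that of the j-th point, minus 1. *)
Lemma cube_few_incomplete n (A : set (Rn R n)) : (A #<= `I_n)%card ->
  ~ complete_exp_system (unit_cube R n) A.
Proof.
move=> /pcard_leP[g]; apply/incompleteP.
pose x0 : Rn R n := [tuple 0 : measurableTypeR R | _ < n].
pose sel (j : nat) := xget x0 [set a | A a /\ g a = j].
exists [tuple (tnth (sel j) j : R) - 1 | j < n] => a Aa.
have gan : (g a < n)%N by exact: (@funS _ _ A `I_n g a Aa).
apply/cube_zero; exists (Ordinal gan), 1 => //.
have sa : sel (g a) = a.
  rewrite /sel; case: xgetP => [y _ [Ay gy]|/(_ a)]; last by move=> /not_andP[].
  by apply: (@inj _ _ A g); rewrite ?inE.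
by rewrite tnth_mktuple tnth_mktuple/= sa; ring.
Qed.

(** Points with nonzero integer first coordinate, seen from the origin. *)
Lemma cube_many_incomplete n N : exists2 a : N.-tuple (Rn R n.+1), injective (tnth a) &
  ~ complete_exp_system (unit_cube R n.+1) (points a).
Proof.
exists [tuple axis n (i.+1%:R) | i < N].
  move=> i j; rewrite !tnth_mktuple => /(congr1 (fun x => tnth x ord0 : R)).
  by rewrite !tnth0/= => /eqP; rewrite eqr_nat eqSS => /eqP/val_inj.
apply/incompleteP; exists (axis n 0) => _ [i _ <-].
apply/cube_zero; exists ord0, (i.+1 : int) => //.
by rewrite !tnth_mktuple !tnth0/= subr0.
Qed.

(** Distinct points on a sphere centred at the origin whose radius is a zero radius. *)
Lemma ball_many_incomplete n N : exists2 a : N.-tuple (Rn R n.+2), injective (tnth a) &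
  ~ complete_exp_system (unit_ball R n.+2) (points a).
Proof.
have [Z [_ /(_ 0)[r Zr r0] _ ZE]] := @ball_zeros R n.
pose c (i : nat) : R := r / i.+1%:R.
pose s i := Num.sqrt (r ^+ 2 - c i ^+ 2).
have cr i : c i ^+ 2 <= r ^+ 2.
  rewrite /c; apply: lerXn2r; rewrite ?nnegrE ?divr_ge0 ?(ltW r0)//.
  by rewrite ler_pdivrMr ?ltr0n// ler_peMr ?(ltW r0) ?ler1n.
exists [tuple tuple_cons (c i : measurableTypeR R, axis n (s i)) | i < N].
  move=> i j; rewrite !tnth_mktuple => /(congr1 (fun x => tnth x ord0 : R)).
  rewrite !tnth0/= => /(mulfI (lt0r_neq0 r0))/invr_inj/eqP.
  by rewrite eqr_nat eqSS => /eqP/val_inj.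
apply/incompleteP; exists (axis n.+1 0) => _ [i _ <-].
apply/ZE; rewrite (_ : enorm _ = r)//; apply: enormP; first exact: ltW.
rewrite tnth_mktuple (_ : Rn_sub _ _ = tuple_cons (c i : measurableTypeR R, axis n (s i))).
  rewrite dotp_cons dotp_axis tnth0/= -expr2 sqr_sqrtr ?subr_ge0//; ring.
apply: eq_from_tnth => j; rewrite tnth_mktuple.
case: (unliftP ord0 j) => [k ->|->]; first by rewrite !tnthS tnth_mktuple subr0.
by rewrite !tnth0/= subr0.
Qed.

(** The perpendicular bisector of the two points is a line of equidistant points. *)
Lemma ball_pair_incomplete (a1 a2 : Rn R 2) : a1 <> a2 ->
  ~ complete_exp_system (unit_ball R 2) [set a1; a2].
Proof.
move=> a12.
pose i0 : 'I_2 := ord0; pose i1 : 'I_2 := lift ord0 ord0.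
pose w j : R := (tnth a1 j : R) - tnth a2 j.
pose u : Rn R 2 := tuple_cons (- w i1 : measurableTypeR R, axis 0 (w i0)).
pose xi : Rn R 2 := [tuple ((tnth a1 j : R) + tnth a2 j) / 2 | j < 2].
have dotp2 (x y : Rn R 2) : dotp x y = tnth x i0 * tnth y i0 + tnth x i1 * tnth y i1 :> R.
  by rewrite /dotp !big_ord_recl big_ord0 addr0.
have ui0 : tnth u i0 = - w i1 :> R by rewrite tnth0.
have ui1 : tnth u i1 = w i0 :> R by rewrite tnthS tnth0.
apply: (@equidistant_incomplete 0 _ xi u ((w i0 ^+ 2 + w i1 ^+ 2) / 4) 0).
  rewrite dotp2 ui0 ui1 mulrNN -!expr2 lt_neqAle addr_ge0 ?sqr_ge0// andbT eq_sym.
  apply/negP; rewrite paddr_eq0 ?sqr_ge0// !sqrf_eq0 => /andP[/eqP w1 /eqP w0].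
  apply: a12; apply: eq_from_tnth => j; apply/eqP; rewrite -subr_eq0; apply/eqP.
  have [->|->] : j = i0 \/ j = i1 by case: j => [[|[|]]//] ?; [left|right]; exact/val_inj.
    exact: w0.
  exact: w1.
by move=> a [->|->]; rewrite !dotp2 ui0 ui1 !tnth_mktuple /w; split; field.
Qed.

(** Three collinear points -t e, 0, t e are enough, the other entries being repetitions
    of the last one. By the parallelogram law, t^2 is determined by the distances from
    xi to the three points, so it suffices to take t^2 outside the countable set of
    values allowed by zero radii. *)
Lemma ball_complete_exists n : [set a : n.+3.-tuple (Rn R n.+3) |
  complete_exp_system (unit_ball R n.+3) (points a)] !=set0.
Proof.
have [Z [Zc _ _ ZE]] := @ball_zeros R n.+1.
pose S := [set (rst.1.1 ^+ 2 + rst.2 ^+ 2 - 2 * rst.1.2 ^+ 2) / 2 | rst in Z `*` Z `*` Z].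
have Sc : countable S.
  apply: sub_countable (card_image_le _ _) _.
  by apply: countableX => //; exact: countableX.
have [q [q0 Sq]] : exists q : R, 0 <= q /\ ~ S q.
  apply: contrapT => H.
  have sub : (`[0, 1]%classic : set (measurableTypeR R)) `<=` S.
    move=> q /=; rewrite in_itv/= => /andP[q0 _]; apply: contrapT => Sq.
    by apply: H; exists q.
  have := countable_lebesgue_measure0 (sub_countable (subset_card_le sub) Sc).
  by rewrite lebesgue_segment01 => /eqP; rewrite onee_eq0.
pose t := Num.sqrt q.
pose p : n.+3.-tuple (Rn R n.+3) := [tuple axis n.+2 (if i == 0 :> nat then - t else
  if i == 1 :> nat then 0 else t) | i < n.+3].
exists p; apply: contrapT => /incompleteP[xi H]; apply: Sq.
have Hk (k : 'I_n.+3) s : s = (if k == 0 :> nat then - t else if k == 1 :> nat then 0 else t) ->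
    Z (enorm (Rn_sub (axis n.+2 s) xi)).
  by move=> ->; apply/ZE; apply: H; exists k => //; rewrite tnth_mktuple.
have E s : enorm (Rn_sub (axis n.+2 s) xi) ^+ 2 = dotp xi xi - 2 * s * tnth xi ord0 + s ^+ 2.
  rewrite enorm_sqr /dotp [in LHS]big_ord_recl [in RHS]big_ord_recl !tnth_mktuple !tnth0/=.
  rewrite (eq_bigr (fun i => (tnth xi (lift ord0 i) : R) * tnth xi (lift ord0 i))).
    ring.
  by move=> i _; rewrite !tnth_mktuple !tnthS tnth_mktuple; ring.
exists (enorm (Rn_sub (axis n.+2 (- t)) xi), enorm (Rn_sub (axis n.+2 0) xi),
  enorm (Rn_sub (axis n.+2 t) xi)).
  split; first split => /=.
  - exact: (Hk ord0).
  - exact: (Hk (lift ord0 ord0)).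
  - exact: (Hk (lift ord0 (lift ord0 ord0))).
by rewrite /= !E sqrrN sqr_sqrtr//; field.
Qed.

End geometry.

(** * Tuples of points and the ball *)
Section ball_tuples.
Context {R : realType}.

Definition edge m n (k : 'I_m) (j : 'I_n) (a : m.+1.-tuple (Rn R n)) : R :=
  tuple_coord (lift ord0 k, j) a - tuple_coord (ord0, j) a.

Lemma polyfun_edge m n k j : polyfun (@tuple_coord R m.+1 n) (edge k j).
Proof. by apply: polyfun_sub; exact: polyfun_gen. Qed.

(** Points a_0, ..., a_d of R^d at distances r_0, ..., r_d from a common point
    xi = a_0 + e. Subtracting the equation of the first sphere from the others gives the
    linear system 2 M e = v, with M the matrix of edges a_(k+1) - a_0 and v the column
    radii_col. Cramer's rule 2 det(M) e = adj(M) v and |e|^2 = r_0^2 then yield a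
    relation without xi, which also holds when M is singular. *)
Section cosphere.
Variables (n : nat) (r : 'I_n.+2 -> R).
Implicit Types a : n.+2.-tuple (Rn R n.+1).

Definition edge_mx a : 'M[R]_n.+1 := \matrix_(k, j) edge k j a.

Definition radii_col a : 'cV[R]_n.+1 :=
  \col_k (\sum_j edge k j a ^+ 2 - r (lift ord0 k) ^+ 2 + r ord0 ^+ 2).

Definition cosphere_poly a : R :=
  \sum_j (\adj (edge_mx a) *m radii_col a) j 0 ^+ 2
  - 4 * \det (edge_mx a) ^+ 2 * r ord0 ^+ 2.

Lemma polyfun_cosphere_poly : polyfun (@tuple_coord R n.+2 n.+1) cosphere_poly.
Proof.
have aM k j : polyfun (@tuple_coord R n.+2 n.+1) (fun a => edge_mx a k j).
  rewrite (_ : (fun _ => _) = edge k j); first exact: polyfun_edge.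
  by apply/funext => a; rewrite mxE.
apply: polyfun_sub; last first.
  apply: polyfun_mul; last exact: polyfun_cst.
  by apply: polyfun_mul; [exact: polyfun_cst|apply: polyfun_sqr; exact: polyfun_det].
apply: polyfun_sum => j _; apply: polyfun_sqr.
rewrite (_ : (fun _ => _) = fun a => \sum_k (\adj (edge_mx a)) j k * radii_col a k 0); last first.
  by apply/funext => a; rewrite mxE.
apply: polyfun_sum => k _; apply: polyfun_mul; first exact: polyfun_adj.
rewrite (_ : (fun _ => _) = fun a => \sum_j edge k j a ^+ 2 -
    cst (r (lift ord0 k) ^+ 2) a + cst (r ord0 ^+ 2) a); last first.
  by apply/funext => a; rewrite mxE.
apply: polyfun_add; last exact: polyfun_cst.
apply: polyfun_sub; last exact: polyfun_cst.
by apply: polyfun_sum => i _; apply: polyfun_sqr; exact: polyfun_edge.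
Qed.

Lemma cosphere_poly0 a (xi : Rn R n.+1) :
  (forall k, dotp (Rn_sub (tnth a k) xi) (Rn_sub (tnth a k) xi) = r k ^+ 2) ->
  cosphere_poly a = 0.
Proof.
move=> H; pose e : 'cV[R]_n.+1 := \col_j ((tnth xi j : R) - tnth (tnth a ord0) j).
have e2 : \sum_j e j 0 ^+ 2 = r ord0 ^+ 2.
  by rewrite -H; apply: eq_bigr => j _; rewrite mxE !tnth_mktuple; ring.
have Me : radii_col a = 2 *: (edge_mx a *m e).
  apply/matrixP => k l; rewrite !ord1 !mxE -e2 -H /dotp mulr_sumr -sumrB -big_split/=.
  by apply: eq_bigr => j _; rewrite !mxE !tnth_mktuple /edge /tuple_coord/=; ring.
rewrite /cosphere_poly Me -scalemxAr mulmxA mul_adj_mx mul_scalar_mx -e2 mulr_sumr -sumrB.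
by apply: big1 => j _; rewrite !mxE; ring.
Qed.

(** At the vertices 0, t e_1, ..., t e_d with t > 2 r_0 + r_1. The relation would give
    a vector e with |e| = r_0 and 2 t e_1 = t^2 - r_1^2 + r_0^2 > 2 t r_0. *)
Lemma cosphere_poly_neq0 : (forall k, 0 <= r k) -> exists a, cosphere_poly a != 0.
Proof.
move=> r0; pose t := 2 * r ord0 + r (lift ord0 ord0) + 1.
have rr0 := r0 ord0; have rr1 := r0 (lift ord0 ord0).
have t0 : 0 < t by rewrite /t; lra.
pose a : n.+2.-tuple (Rn R n.+1) := [tuple [tuple (if unlift ord0 i == Some j then t else 0 : measurableTypeR R)
  | j < n.+1] | i < n.+2].
have aE k j : edge k j a = if k == j then t else 0.
  by rewrite /edge /tuple_coord /= !tnth_mktuple liftK unlift_none/= subr0.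
have ME : edge_mx a = t%:M.
  by apply/matrixP => k j; rewrite !mxE aE; case: eqP.
exists a; apply/eqP => P0.
set y := \adj (edge_mx a) *m radii_col a.
have dn0 : \det (edge_mx a) != 0 by rewrite ME det_scalar expf_neq0// gt_eqF.
have yE : t * y ord0 0 = \det (edge_mx a) * radii_col a ord0 0.
  have : edge_mx a *m y = \det (edge_mx a) *: radii_col a.
    by rewrite /y mulmxA mul_mx_adj mul_scalar_mx.
  by rewrite {1}ME mul_scalar_mx => /matrixP/(_ ord0 0); rewrite !mxE.
have vE : radii_col a ord0 0 = t ^+ 2 - r (lift ord0 ord0) ^+ 2 + r ord0 ^+ 2.
  rewrite mxE (bigD1 ord0)//= aE eqxx big1 ?addr0// => j j0.
  by rewrite aE eq_sym (negbTE j0) expr0n.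
have y0 : y ord0 0 ^+ 2 <= 4 * \det (edge_mx a) ^+ 2 * r ord0 ^+ 2.
  move/eqP: P0; rewrite subr_eq0 => /eqP <-.
  by rewrite (bigD1 ord0)//= lerDl sumr_ge0// => j _; rewrite sqr_ge0.
set D := \det (edge_mx a) in dn0 yE y0.
set v := radii_col a ord0 0 in yE vE.
have : D ^+ 2 * v ^+ 2 <= D ^+ 2 * (4 * t ^+ 2 * r ord0 ^+ 2).
  rewrite -exprMn -yE exprMn.
  have := ler_wpM2l (sqr_ge0 t) y0; move=> h; apply: le_trans h _.
  by rewrite le_eqVlt; apply/orP; left; apply/eqP; ring.
rewrite ler_pM2l ?exprn_even_gt0//=.
have : 2 * t * r ord0 < v by rewrite vE /t; nra.
move=> h1 h2; have h3 : 0 <= 2 * t * r ord0 by rewrite !mulr_ge0// ltW.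
have h4 : (2 * t * r ord0) ^+ 2 < v ^+ 2 by rewrite ltrXn2r// nnegrE// ltW// (le_lt_trans h3).
by move: h4; rewrite ltNge => /negP; apply; apply: le_trans h2 _; rewrite !exprMn -natrX.
Qed.

End cosphere.

Lemma ball_incomplete_null n :
  null_tuples [set a : n.+3.-tuple (Rn R n.+2) |
    ~ complete_exp_system (unit_ball R n.+2) (points a)].
Proof.
have [Z [Zc _ Zpos ZE]] := @ball_zeros R n.
pose F (r : 'I_n.+3 -> R) := [set a | cosphere_poly r a = 0].
apply: (@negligibleS _ _ _ _ (\bigcup_(r in [set r | forall i, Z (r i)]) F r)).
  move=> a /= /incompleteP[xi H].
  exists (fun k => enorm (Rn_sub (tnth a k) xi)) => [k|]; first by apply/ZE/H; exists k.
  by apply: (@cosphere_poly0 _ _ _ xi) => k; rewrite enorm_sqr.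
apply: negligible_countable; first exact: countable_families.
move=> r Zr; have [p pP] : exists p, cosphere_poly r p != 0.
  by apply: cosphere_poly_neq0 => k; exact/ltW/Zpos.
exact: null_zero_polyfun (polyfun_cosphere_poly r) pP.
Qed.

Definition minor_mx n (a : n.+2.-tuple (Rn R n.+2)) : 'M[R]_n.+1 :=
  \matrix_(k, j) edge k (lift ord0 j) a.

(** If the minor is invertible, the linear system that expresses equidistance to all the
    points can be solved for any prescribed first coordinate, so the solutions contain
    a line. In the proof, e is the solution with first coordinate 0, relative to the
    first point, and u directs the line. *)
Lemma minor_incomplete n (a : n.+2.-tuple (Rn R n.+2)) :
  \det (minor_mx a) != 0 -> ~ complete_exp_system (unit_ball R n.+2) (points a).
Proof.
move=> d0; have Mu : minor_mx a \in unitmx by rewrite unitmxE unitfE.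
pose vec (s : R) (z : 'cV[R]_n.+1) : Rn R n.+2 :=
  tuple_cons (s : measurableTypeR R, [tuple (z i 0 : measurableTypeR R) | i < n.+1]).
have vecE s z k : \sum_j edge k j a * tnth (vec s z) j = edge k ord0 a * s + (minor_mx a *m z) k 0.
  rewrite big_ord_recl tnth0/= mxE; congr (_ + _).
  by apply: eq_bigr => j _; rewrite tnthS tnth_mktuple mxE.
pose z0 := invmx (minor_mx a) *m \col_k ((\sum_j edge k j a ^+ 2) / 2).
pose zu := invmx (minor_mx a) *m - \col_k edge k ord0 a.
pose e := vec 0 z0; pose u := vec 1 zu.
have eE k : \sum_j edge k j a * tnth e j = (\sum_j edge k j a ^+ 2) / 2.
  by rewrite vecE mulr0 add0r mulKVmx// mxE.
have uE k : \sum_j edge k j a * tnth u j = 0.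
  by rewrite vecE mulr1 mulKVmx// !mxE subrr.
pose xi : Rn R n.+2 := [tuple (tnth (tnth a ord0) j : R) + tnth e j | j < n.+2].
apply: (@equidistant_incomplete _ _ _ xi u (dotp e e) (- dotp e u)).
  by rewrite dotp_cons expr1n ltr_wpDr// dotp_ge0.
move=> _ [i _ <-]; case: (unliftP ord0 i) => [k ->|->]; split.
- transitivity (dotp e e + (\sum_j edge k j a ^+ 2 - 2 * \sum_j edge k j a * tnth e j)).
    rewrite mulr_sumr -sumrB -big_split/=; apply: eq_bigr => j _.
    by rewrite !tnth_mktuple /edge /tuple_coord/=; ring.
  by rewrite eE mulrC divfK ?subrr ?addr0// pnatr_eq0.
- transitivity (\sum_j edge k j a * tnth u j - dotp e u); last by rewrite uE sub0r.
  rewrite -sumrB; apply: eq_bigr => j _.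
  by rewrite !tnth_mktuple /edge /tuple_coord/=; ring.
- by apply: eq_bigr => j _; rewrite !tnth_mktuple; ring.
- by rewrite -sumrN; apply: eq_bigr => j _; rewrite !tnth_mktuple; ring.
Qed.

Lemma ball_complete_null n :
  null_tuples [set a : n.+2.-tuple (Rn R n.+2) |
    complete_exp_system (unit_ball R n.+2) (points a)].
Proof.
apply: (@negligibleS _ _ _ _ [set a | \det (minor_mx a) = 0]).
  by move=> a /= ca; apply/eqP/negPn/negP => /minor_incomplete.
pose p : n.+2.-tuple (Rn R n.+2) := [tuple [tuple ((unlift ord0 i == unlift ord0 j)%:R
  : measurableTypeR R) | j < n.+2] | i < n.+2].
apply: (@null_zero_polyfun _ _ _ _ p).
  apply: polyfun_det => k j; rewrite (_ : (fun _ => _) = edge k (lift ord0 j)); first exact: polyfun_edge.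
  by apply/funext => a; rewrite mxE.
rewrite (_ : minor_mx p = 1%:M) ?det1 ?oner_neq0//.
apply/matrixP => k j; rewrite !mxE /edge /tuple_coord/= !tnth_mktuple !liftK unlift_none subr0.
by rewrite (inj_eq (@Some_inj _)).
Qed.

End ball_tuples.

Theorem theorem1p4 (R : realType) (d : nat) (hd : (2 <= d)%N) :
  (forall Om : set (Rn R d), Om = unit_ball R d \/ Om = unit_cube R d ->
     null_tuples [set a : d.+1.-tuple (Rn R d) |
                   ~ complete_exp_system Om (points a)]) /\
  (forall A : set (Rn R d), (A #<= `I_d)%card ->
     ~ complete_exp_system (unit_cube R d) A) /\
  null_tuples [set a : d.-tuple (Rn R d) |
                complete_exp_system (unit_ball R d) (points a)] /\
  (forall Om : set (Rn R d), Om = unit_ball R d \/ Om = unit_cube R d ->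
     forall N : nat, (d.+1 <= N)%N ->
     exists2 a : N.-tuple (Rn R d), injective (tnth a) &
       ~ complete_exp_system Om (points a)) /\
  (d = 2%N -> forall a1 a2 : Rn R d, a1 <> a2 ->
     ~ complete_exp_system (unit_ball R d) [set a1; a2]) /\
  ((3 <= d)%N ->
     [set a : d.-tuple (Rn R d) |
       complete_exp_system (unit_ball R d) (points a)] !=set0).
Proof.
case: d hd => [|[|n]]// _; do 5 ?[split].
- by move=> Om [->|->]; [exact: ball_incomplete_null|exact: cube_incomplete_null].
- exact: cube_few_incomplete.
- exact: ball_complete_null.
- by move=> Om [->|->] N _; [exact: ball_many_incomplete|exact: cube_many_incomplete].
- by case=> ->; exact: ball_pair_incomplete.
- by case: n => // n _; exact: ball_complete_exists.
Qed.
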